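(* There exist positive constants $c_1,c_2,c_3$, depending only on $\nu,c_L,c_U$, and for every constant $c>0$ a constant $\tilde c\in(0,1)$, depending only on $c,\nu,c_L,c_U$, with $\tilde c\to 0$ as $c\to\infty$, such that the following holds. Let $$\lambda=t\nu\sqrt{\frac{(1+\tau)\log p}{n}},\qquad \gamma=2\sqrt{\frac{\tau}{c_L}},$$ and let $\tilde\alpha$ be any solution of $$\tilde\alpha\in\operatorname*{argmin}_{\|\beta\|_2\le\gamma}\ \tfrac12\beta^T\hat\Sigma\beta-\beta^T\hat\mu+\lambda\|\beta\|_1,\qquad\text{and}\qquad \tilde\theta=2\hat\mu^T\tilde\alpha-\tilde\alpha^T\hat\Sigma\tilde\alpha.$$ If $\frac{s\log p}{n}<\tilde c$, then for all $t>\max(1,2/c_2)$, $$\sup_{(\mu,\Sigma)\in\mathcal H(s,\tau)}\mathbb E\|\tilde\alpha-\alpha\|_2^2\le c_1\Big(\frac{t^2(1+\tau)s\log p}{n}+\tau\,p^{-\min(c_2t-1,\,c)}\Big),$$ $$\sup_{(\mu,\Sigma)\in\mathcal H(s,\tau)}\mathbb E|\tilde\theta-\theta|\le c_3\Big(\frac{t^2(1+\tau)s\log p}{n}+(\tau+\sqrt\tau)\big(n^{-1/2}+p^{-\min(c_2t-2,\,c-1)/2}\big)\Big).$$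
   Context: Model: $x_1,\dots,x_n\in\mathbb R^p$ are i.i.d. copies of $x=\Sigma^{1/2}y+\mu$, where $\mu\in\mathbb R^p$, $\Sigma$ is a symmetric positive definite $p\times p$ matrix, and $y\in\mathbb R^p$ is zero-mean and isotropic ($\mathbb E yy^T=I_p$) and satisfies $\mathbb P(|b^Ty|\ge t)\le 2\exp(-t^2/\nu^2)$ for all $t\ge0$ and all $\|b\|_2=1$, with $\nu>0$ a fixed constant. Thus $\mathbb E x=\mu$, $\operatorname{cov}(x)=\Sigma$. Put $\alpha=\Sigma^{-1}\mu$, $\theta=\mu^T\Sigma^{-1}\mu$. Sample mean and covariance: $\hat\mu=\frac1n\sum_{i=1}^n x_i$, $\hat\Sigma=\frac1n\sum_{i=1}^n(x_i-\hat\mu)(x_i-\hat\mu)^T$. Parameter space: with fixed constants $0<c_L<c_U$, an integer $1\le s\le p$ and $\tau>0$, $$\mathcal H(s,\tau)=\{(\mu,\Sigma):\|\Sigma^{-1}\mu\|_0\le s,\ \mu^T\Sigma^{-1}\mu\le\tau,\ c_L\le\lambda_{\min}(\Sigma)\le\delta_\Sigma\le c_U\},$$ where $\|\cdot\|_0$ counts nonzero entries and $\delta_\Sigma=\max_i\Sigma_{ii}$. The bounds hold for every distribution of $y$ on $\mathbb R^p$ that is zero-mean, isotropic ($\mathbb E yy^T=I_p$) and satisfies $\mathbb P(|b^Ty|\ge t)\le 2\exp(-t^2/\nu^2)$ for all $t\ge0$ and all $\|b\|_2=1$ (suprema may be read as also being over all distributions of $y$ with these properties). *)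

(* Defs.v *)
From HB Require Import structures.
From mathcomp Require Import all_boot all_order all_algebra.
From mathcomp Require Import all_classical all_reals all_analysis.

Set Implicit Arguments.
Unset Strict Implicit.
Unset Printing Implicit Defensive.
Import Order.TTheory GRing.Theory Num.Theory.
Import numFieldTopology.Exports numFieldNormedType.Exports.
Local Open Scope classical_set_scope.
Local Open Scope ring_scope.

Section Vectors.
Context {R : realType} {p : nat}.
Implicit Types (u v : 'cV[R]_p) (A : 'M[R]_p).

Definition dotv u v : R := (u^T *m v) 0 0.
Definition qform A v : R := (v^T *m A *m v) 0 0.

Definition norm0 v : nat := #|[set j | v j 0 != 0]%SET|.
Definition norm1 v : R := \sum_j `|v j 0|.
Definition norm2 v : R := Num.sqrt (\sum_j v j 0 ^+ 2).

Definition symposdef A : Prop := A^T = A /\ forall v, v != 0 -> 0 < qform A v.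

(* For symmetric A and p > 0 the set is finite and nonempty, so that the
   infimum is the smallest eigenvalue; [inf] of the empty set would be 0. *)
Definition lambda_min A : R := inf [set a | eigenvalue A a].

(* The default value 0 is harmless for the matrices with nonnegative diagonal
   considered here. *)
Definition max_diag A : R := \big[Num.max/0]_(i < p) A i i.

(* S = A^{1/2}; such an S is unique, and it exists when A is [symposdef]. *)
Definition is_sqrtmx A (S : 'M[R]_p) : Prop := symposdef S /\ S *m S = A.

(* The Borel sets of R^p, as the product sigma-algebra: it is generated by the
   preimages of the measurable sets of R under the p coordinate maps. *)
Definition borel_vec : set (set 'cV[R]_p) :=
  g_sigma_preimage (fun (j : 'I_p) (v : 'cV[R]_p) => v j 0).

End Vectors.

Section Sampling.
Context {R : realType} {n p : nat}.

Definition random_vector d (T : measurableType d) (X : T -> 'cV[R]_p) : Prop :=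
  forall j, measurable_fun [set: T] (fun w => X w j 0).

(* Some B i may be the whole space, so this is mutual independence. *)
Definition independent_vectors d (T : measurableType d) (P : probability T R)
    (Y : 'I_n -> T -> 'cV[R]_p) : Prop :=
  forall B : 'I_n -> set 'cV[R]_p, (forall i, borel_vec (B i)) ->
  fine (P [set w | forall i, B i (Y i w)]) = \prod_(i < n) fine (P (Y i @^-1` B i)).

Definition same_distribution d (T : measurableType d) (P : probability T R)
    (Y : 'I_n -> T -> 'cV[R]_p) : Prop :=
  forall i k (B : set 'cV[R]_p), borel_vec B -> P (Y i @^-1` B) = P (Y k @^-1` B).

Definition isotropic_subgaussian d (T : measurableType d) (P : probability T R)
    (nu : R) (y : T -> 'cV[R]_p) : Prop :=
  [/\ forall j, ('E_P[fun w => (y w j 0)%R] = 0)%E,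
      forall j k, ('E_P[fun w => (y w j 0 * y w k 0)%R] = ((j == k)%:R)%:E)%E &
      forall (b : 'cV[R]_p) (t : R), norm2 b = 1 -> 0 <= t ->
        (P [set w | (t <= `|dotv b (y w)|)%R] <= (2 * expR (- (t ^+ 2 / nu ^+ 2)))%:E)%E].

Definition iid_noise d (T : measurableType d) (P : probability T R)
    (nu : R) (Y : 'I_n -> T -> 'cV[R]_p) : Prop :=
  [/\ forall i, random_vector (Y i),
      independent_vectors P Y,
      same_distribution P Y &
      forall i, isotropic_subgaussian P nu (Y i)].

End Sampling.

Section Estimation.
Context {R : realType} {n p : nat}.
Implicit Types (X : 'I_n -> 'cV[R]_p) (mu a : 'cV[R]_p) (Sigma : 'M[R]_p).

Definition mean_hat X : 'cV[R]_p := n%:R^-1 *: \sum_(i < n) X i.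
Definition cov_hat X : 'M[R]_p :=
  n%:R^-1 *: \sum_(i < n) (X i - mean_hat X) *m (X i - mean_hat X)^T.

Definition alpha_of mu Sigma : 'cV[R]_p := invmx Sigma *m mu.
Definition theta_of mu Sigma : R := qform (invmx Sigma) mu.

Definition lasso_objective X (lambda : R) a : R :=
  2^-1 * qform (cov_hat X) a - dotv a (mean_hat X) + lambda * norm1 a.

Definition lasso_solution X (lambda gamma : R) a : Prop :=
  norm2 a <= gamma /\
  forall b, norm2 b <= gamma ->
    lasso_objective X lambda a <= lasso_objective X lambda b.

Definition theta_tilde X a : R := 2 * dotv (mean_hat X) a - qform (cov_hat X) a.

Definition alpha_loss mu Sigma X a : R := norm2 (a - alpha_of mu Sigma) ^+ 2.
Definition theta_loss mu Sigma X a : R := `|theta_tilde X a - theta_of mu Sigma|.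

Definition param_space (cL cU : R) (s : nat) (tau : R) mu Sigma : Prop :=
  symposdef Sigma /\
  [/\ (norm0 (alpha_of mu Sigma) <= s)%N,
      theta_of mu Sigma <= tau,
      cL <= lambda_min Sigma,
      lambda_min Sigma <= max_diag Sigma &
      max_diag Sigma <= cU].

(* Supremum of the expected loss over the parameter space, over all probability
   spaces carrying i.i.d. noise vectors with the required properties, and over
   all measurable selections [alphat] of solutions of the minimization problem
   (which need not have a unique solution). *)
Definition sup_risk (nu cL cU : R) (s : nat) (tau lambda gamma : R)
    (loss : 'cV[R]_p -> 'M[R]_p -> ('I_n -> 'cV[R]_p) -> 'cV[R]_p -> R) : \bar R :=
  ereal_sup [set r | exists mu Sigma, param_space cL cU s tau mu Sigma /\
    exists (root : 'M[R]_p) (d : measure_display) (T : measurableType d)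
           (P : probability T R) (Y : 'I_n -> T -> 'cV[R]_p) (alphat : T -> 'cV[R]_p),
    let X := fun w i => root *m Y i w + mu in
    [/\ is_sqrtmx Sigma root,
        iid_noise P nu Y,
        random_vector alphat,
        forall w, lasso_solution (X w) lambda gamma (alphat w) &
        r = ('E_P[fun w => loss mu Sigma (X w) (alphat w)])%E]].

End Estimation.

(* Main.v *)
(* Put z_i = x_i - mu = Sigma^{1/2} y_i.  On an exceptional event of small
   probability aside, (i) every entry of hat Sigma alpha - hat mu is at most
   lambda / 2 in absolute value and (ii) hat Sigma satisfies a restricted
   eigenvalue condition, and then the usual Lasso argument bounds the loss.
   Only the diagonal of Sigma is bounded from above, so for (ii) one needs a
   lower bound relative to Sigma: a fixed direction v violates
   v' hat Sigma v >= v' Sigma v / 2 with probability exp (- c n) at most, this is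
   imposed on the (2p)^d sums v of d signed coordinate vectors, and a
   derandomized version of Maurey's argument transfers it to every v at the cost
   of a multiple of |v|_1^2 / d (Oliveira's transfer principle).
   The exceptional event is handled by dominating its indicator by a sum of
   exponentials of deviations, whose means are bounded by moment generating
   functions; on that event the constraint |beta| <= gamma bounds the first loss
   and a comparison with beta = 0 bounds the second one. *)

(* The level d is a fixed multiple of s: on the Lasso cone |v|_1^2 <= 16 s |v|_2^2, and the transfer
   error must stay below the curvature. The union over signed sums then costs exp (C s log p),
   affordable when s log p / n is small, and dividing that threshold by 1 + c leaves enough of exp
   (- c' n) to reach p^(-c). This is the origin of tilde c. The exponent c_2 t - 1 loses 1 to the
   union over coordinates. In the second bound |mu|_2 may grow like sqrt p, because only the
   diagonal of Sigma is bounded; on the exceptional event this leaves at most sqrt p * p^(-m/2) with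
   m = min (c_2 t - 1, c), which is the exponent in the statement. There |hat mu - mu| is unbounded
   and depends on the event; a weighted arithmetic-geometric mean inequality separates the two, so
   that each factor is averaged on its own. Every risk bound is a pointwise inequality between the
   loss and a measurable function of explicit mean, integrated at the end. *)
Require Import Defs.
From HB Require Import structures.
From mathcomp Require Import all_boot all_order all_algebra.
From mathcomp Require Import all_classical all_reals all_analysis.
From mathcomp Require Import measurable_realfun ring lra.

Set Implicit Arguments.
Unset Strict Implicit.
Unset Printing Implicit Defensive.
Import Order.TTheory GRing.Theory Num.Theory.
Import numFieldTopology.Exports numFieldNormedType.Exports.
Local Open Scope classical_set_scope.
Local Open Scope ring_scope.

(** * Euclidean geometry and the smallest eigenvalue *)

Section LinearAlgebra.
Context {R : realType} {p : nat}.
Implicit Types (u v w : 'cV[R]_p) (A B : 'M[R]_p).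

Lemma dotvE u v : dotv u v = \sum_j u j 0 * v j 0.
Proof. by rewrite /dotv mxE; apply: eq_bigr => j _; rewrite mxE. Qed.

Lemma dotvC u v : dotv u v = dotv v u.
Proof. by rewrite !dotvE; apply: eq_bigr => j _; rewrite mulrC. Qed.

Lemma dotvDr u v w : dotv u (v + w) = dotv u v + dotv u w.
Proof. by rewrite /dotv mulmxDr mxE. Qed.

Lemma dotvZr u v a : dotv u (a *: v) = a * dotv u v.
Proof. by rewrite /dotv -scalemxAr mxE. Qed.

Lemma dotvDl u v w : dotv (u + v) w = dotv u w + dotv v w.
Proof. by rewrite dotvC dotvDr !(dotvC w). Qed.

Lemma dotvZl u v a : dotv (a *: u) v = a * dotv u v.
Proof. by rewrite dotvC dotvZr dotvC. Qed.

Lemma dotvNr u v : dotv u (- v) = - dotv u v.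
Proof. by rewrite -scaleN1r dotvZr mulN1r. Qed.

Lemma dotvNl u v : dotv (- u) v = - dotv u v.
Proof. by rewrite dotvC dotvNr dotvC. Qed.

Lemma dotvBr u v w : dotv u (v - w) = dotv u v - dotv u w.
Proof. by rewrite dotvDr dotvNr. Qed.

Lemma dotv_sumr I (r : seq I) (P : pred I) u (F : I -> 'cV[R]_p) :
  dotv u (\sum_(i <- r | P i) F i) = \sum_(i <- r | P i) dotv u (F i).
Proof.
apply: (big_morph (dotv u)) => [v w|]; first exact: dotvDr.
by rewrite -(scale0r 0) dotvZr mul0r.
Qed.

Lemma dotv_mulmx u A v : dotv u (A *m v) = dotv (A^T *m u) v.
Proof. by rewrite /dotv trmx_mul trmxK mulmxA. Qed.

Lemma dotv_delta j v : dotv (delta_mx j 0) v = v j 0.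
Proof.
rewrite dotvE (bigD1 j)//= mxE !eqxx mul1r big1 ?addr0// => k kj.
by rewrite mxE (negbTE kj) mul0r.
Qed.

Lemma qformE A v : qform A v = dotv v (A *m v).
Proof. by rewrite /qform /dotv mulmxA. Qed.

Lemma dotvv_ge0 v : 0 <= dotv v v.
Proof. by rewrite dotvE; apply: sumr_ge0 => j _; rewrite -expr2 sqr_ge0. Qed.

Lemma norm2_ge0 v : 0 <= norm2 v.
Proof. exact: sqrtr_ge0. Qed.

Lemma norm2_sqr v : norm2 v ^+ 2 = dotv v v.
Proof.
rewrite /norm2 dotvE sqr_sqrtr; last by apply: sumr_ge0 => j _; rewrite sqr_ge0.
by apply: eq_bigr => j _; rewrite expr2.
Qed.

Lemma norm2_sqrt v : norm2 v = Num.sqrt (dotv v v).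
Proof. by rewrite -norm2_sqr sqrtr_sqr ger0_norm ?norm2_ge0. Qed.

Lemma norm2Z a v : norm2 (a *: v) = `|a| * norm2 v.
Proof.
by rewrite !norm2_sqrt dotvZl dotvZr mulrA -expr2 sqrtrM ?sqr_ge0// sqrtr_sqr.
Qed.

Lemma norm2_eq0 v : (norm2 v == 0) = (v == 0).
Proof.
apply/idP/eqP => [/eqP v0|->]; last first.
  by rewrite -(scale0r 0) norm2Z normr0 mul0r.
apply/matrixP => j k; rewrite ord1 mxE; apply/eqP.
have /eqP : dotv v v = 0 by rewrite -norm2_sqr v0 expr0n.
rewrite dotvE psumr_eq0; last by move=> i _; rewrite -expr2 sqr_ge0.
by move=> /allP/(_ j); rewrite mem_index_enum mulf_eq0 orbb; exact.
Qed.

Lemma discriminant_le (a b c : R) :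
  (forall t, 0 <= a + 2 * b * t + c * t ^+ 2) -> b ^+ 2 <= a * c.
Proof.
move=> H; have [c0|c0] := eqVneq c 0.
  have [->|b0] := eqVneq b 0; first by rewrite c0 mulr0 expr0n.
  have := H (- (a + 1) / (2 * b)); rewrite c0 mul0r addr0.
  rewrite mulrC divfK ?mulf_neq0// => ?; lra.
have c_gt0 : 0 < c.
  rewrite lt_neqAle eq_sym c0 /= leNgt; apply/negP => cn.
  (* Large enough for the quadratic term to win: [c * t <= - (|a| + 2 |b| + 1)] and [t >= 1]. *)
  set t := (`|a| + 2 * `|b| + 1) / (- c) + 1.
  have t1 : 1 <= t.
    by rewrite lerDr divr_ge0 ?oppr_ge0 ?(ltW cn).
  have := H t; apply/negP; rewrite -ltNge.
  have ct : c * t = - (`|a| + 2 * `|b| + 1) + c.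
    by rewrite /t; field.
  have Ha := ler_norm a; have Hb := ler_norm b.
  rewrite expr2 mulrA ct.
  have := normr_ge0 a; have := normr_ge0 b; nra.
have := H (- b / c).
have -> : a + 2 * b * (- b / c) + c * (- b / c) ^+ 2 = (a * c - b ^+ 2) / c by field.
by rewrite pmulr_lge0 ?invr_gt0// subr_ge0.
Qed.

(** The discriminant of [t -> qform A (u + t *: v)]. Semidefiniteness suffices, and this matters
    below for [A - m%:M], whose form has infimum 0 on the unit sphere. *)
Lemma psd_cauchy_schwarz A u v : A^T = A -> (forall w, 0 <= qform A w) ->
  dotv u (A *m v) ^+ 2 <= qform A u * qform A v.
Proof.
move=> sA A0; apply: discriminant_le => t.
have := A0 (u + t *: v); rewrite !qformE mulmxDr dotvDr !dotvDl -scalemxAr.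
rewrite !dotvZl !dotvZr (dotv_mulmx v A u) sA (dotvC (A *m v)).
by congr (_ <= _); ring.
Qed.

Lemma cauchy_schwarz u v : `|dotv u v| <= norm2 u * norm2 v.
Proof.
rewrite -ler_sqr ?nnegrE ?normr_ge0 ?mulr_ge0 ?norm2_ge0//.
rewrite exprMn !norm2_sqr real_normK ?num_real//.
have := @psd_cauchy_schwarz 1%:M u v (trmx1 _ _).
rewrite !qformE !mul1mx; apply => w; rewrite qformE mul1mx; exact: dotvv_ge0.
Qed.

Lemma norm2_triangle u v : norm2 (u + v) <= norm2 u + norm2 v.
Proof.
rewrite -ler_sqr ?nnegrE ?addr_ge0 ?norm2_ge0// sqrrD !norm2_sqr.
rewrite dotvDl !dotvDr (dotvC v u).
have := le_trans (ler_norm _) (cauchy_schwarz u v).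
by rewrite mulr2n; lra.
Qed.

Lemma norm2N v : norm2 (- v) = norm2 v.
Proof. by rewrite -scaleN1r norm2Z normrN1 mul1r. Qed.

Lemma dotv_mulmx_bound A v :
  dotv v (A *m v) <= (\sum_i \sum_j `|A i j|) * dotv v v.
Proof.
rewrite dotvE mulr_suml; apply: ler_sum => i _.
rewrite mxE mulr_sumr mulr_suml; apply: ler_sum => j _.
rewrite mulrCA (le_trans (ler_norm _))// normrM ler_wpM2l//.
have sq k : v k 0 ^+ 2 <= dotv v v.
  rewrite dotvE (bigD1 k)//= -expr2 lerDl.
  by apply: sumr_ge0 => l _; rewrite -expr2 sqr_ge0.
have := sq i; have := sq j; rewrite normrM.
rewrite -(real_normK (num_real (v i 0))) -(real_normK (num_real (v j 0))).
have := sqr_ge0 (`|v i 0| - `|v j 0|).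
by move: (dotv v v) `|v i 0| `|v j 0| => D x y; nra.
Qed.

Lemma unit_direction v : (0 < p)%N ->
  exists2 u, norm2 u = 1 & v = norm2 v *: u.
Proof.
move=> p0; have [->|v0] := eqVneq v 0.
  exists (delta_mx (Ordinal p0) 0).
    by rewrite norm2_sqrt dotv_delta mxE !eqxx sqrtr1.
  by rewrite (eqP (_ : norm2 0 == 0)) ?scale0r// norm2_eq0.
have n0 : norm2 v != 0 by rewrite norm2_eq0.
exists ((norm2 v)^-1 *: v).
  by rewrite norm2Z ger0_norm ?invr_ge0 ?norm2_ge0// mulVf.
by rewrite scalerA mulfV// scale1r.
Qed.

(** The infimum [m] of the form on the unit sphere is an eigenvalue, shown without compactness or
    diagonalization: were [B = A - m%:M] invertible, its form would be bounded away from 0 on the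
    sphere, against the choice of [m]. *)
Lemma lambda_min_le_qform A v : symposdef A -> lambda_min A * dotv v v <= qform A v.
Proof.
move=> [sA pA]; have [->|v0] := eqVneq v 0.
  by rewrite qformE mulmx0 /dotv mulmx0 mxE mulr0.
have p0 : (0 < p)%N.
  case: (p) v v0 {sA pA A} => // v /eqP[]; apply/matrixP => -[]//.
pose S := [set qform A w | w in [set w | norm2 w = 1]].
have qA0 w : 0 <= qform A w.
  have [->|/pA/ltW//] := eqVneq w 0.
  by rewrite qformE mulmx0 /dotv mulmx0 mxE.
have S_lb : has_lbound S by exists 0 => _ [w _ <-].
have S_inf : has_inf S.
  split=> //; have [u u1 _] := unit_direction v p0.
  by exists (qform A u); exists u.
have scaleq B c w : qform B (c *: w) = c ^+ 2 * qform B w.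
  by rewrite !qformE -scalemxAr dotvZl dotvZr mulrA expr2.
set m := inf S; have m_le w : m * dotv w w <= qform A w.
  have [u u1 ->] := unit_direction w p0.
  rewrite scaleq dotvZl dotvZr -(norm2_sqr u) u1 expr1n mulr1 mulrC.
  by rewrite -expr2 ler_wpM2l ?sqr_ge0//; apply: ge_inf => //; exists u.
pose B := A - m%:M.
have qB w : qform B w = qform A w - m * dotv w w.
  by rewrite !qformE mulmxBl dotvBr mul_scalar_mx dotvZr.
have B0 w : 0 <= qform B w by rewrite qB subr_ge0.
have sB : B^T = B by rewrite /B linearB /= tr_scalar_mx sA.
have B_sing : B \notin unitmx.
  apply/negP => uB.
  set M := \sum_i \sum_j `|invmx B i j|.
  have M0 : 0 <= M by do 2 apply: sumr_ge0 => ? _.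
  have M1 : 0 < M + 1 by rewrite ltr_wpDl.
  have lbB w : norm2 w = 1 -> (M + 1)^-1 <= qform B w.
    (* Cauchy-Schwarz for the form of [B] at [w] and [invmx B *m w]: the pairing is |w|^2 = 1, and
       the form at the second vector is that of [invmx B] at [w], hence at most [M]. *)
    move=> w1; have := psd_cauchy_schwarz w (invmx B *m w) sB B0.
    rewrite !qformE mulKVmx// -(qformE B w) -norm2_sqr w1 !expr1n.
    rewrite (dotvC (invmx B *m w)) => H.
    have := dotv_mulmx_bound (invmx B) w; rewrite -norm2_sqr w1 expr1n mulr1 => H2.
    rewrite -[_^-1]mul1r ler_pdivrMr//; have := B0 w; rewrite -/M in H2; nra.
  have iM : 0 < (M + 1)^-1 by rewrite invr_gt0.
  have [_ [w w1 <-]] := inf_adherent iM S_inf.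
  have := lbB w w1; rewrite qB -norm2_sqr w1 expr1n mulr1 -/m; lra.
have eig : eigenvalue A m.
  by rewrite /eigenvalue /eigenspace kermx_eq0 row_free_unit.
apply: le_trans (m_le v); rewrite ler_wpM2r ?dotvv_ge0//.
(* [inf] is meaningful only for a set bounded below; positive definiteness makes 0 a lower bound of
   the eigenvalues. *)
apply: ge_inf => //; exists 0 => a /eigenvalueP[w wA w0].
have := pA w^T; rewrite qformE dotv_mulmx sA.
have -> : A *m w^T = a *: w^T by rewrite -{1}sA -trmx_mul wA linearZ.
rewrite dotvZl -norm2_sqr => H; rewrite -(@pmulr_lge0 _ (norm2 w^T ^+ 2)).
  by rewrite ltW// H//; apply: contraNneq w0 => /eqP; rewrite trmx_eq0.
rewrite exprn_gt0// lt_neqAle norm2_ge0 andbT eq_sym norm2_eq0.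
by rewrite trmx_eq0.
Qed.

End LinearAlgebra.

(** * Transfer principle and Lasso error bounds *)

Section Transfer.
Context {R : realType} {p : nat}.
Implicit Types (u v x : 'cV[R]_p) (A : 'M[R]_p).

Definition signed_delta (k : 'I_p * bool) : 'cV[R]_p :=
  (-1) ^+ k.2 *: delta_mx k.1 0.

Definition signed_sum (f : seq ('I_p * bool)) : 'cV[R]_p :=
  \sum_(k <- f) signed_delta k.

Lemma norm1_ge0 v : 0 <= norm1 v.
Proof. exact: sumr_ge0. Qed.

Lemma norm1Z a v : norm1 (a *: v) = `|a| * norm1 v.
Proof.
by rewrite /norm1 mulr_sumr; apply: eq_bigr => j _; rewrite mxE normrM.
Qed.

Lemma norm1_eq0 v : (norm1 v == 0) = (v == 0).
Proof.
apply/idP/eqP => [|->]; last by rewrite -(scale0r 0) norm1Z normr0 mul0r.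
rewrite psumr_eq0// => /allP v0; apply/matrixP => j k; rewrite ord1 mxE.
by apply/eqP; rewrite -normr_eq0; apply: v0; rewrite mem_index_enum.
Qed.

Lemma qformZ A a v : qform A (a *: v) = a ^+ 2 * qform A v.
Proof. by rewrite !qformE -scalemxAr dotvZl dotvZr mulrA expr2. Qed.

Lemma qformD A u v : qform A (u + v) =
  qform A u + (dotv u (A *m v) + dotv v (A *m u)) + qform A v.
Proof. by rewrite !qformE mulmxDr !dotvDl !dotvDr; ring. Qed.

Lemma qform_delta A j : qform A (delta_mx j 0) = A j j.
Proof.
rewrite qformE dotv_delta !mxE (bigD1 j)//= mxE !eqxx mulr1 big1 ?addr0//.
by move=> k kj; rewrite mxE (negbTE kj) mulr0.
Qed.

(** One step of the method of conditional expectations: if every value exceeded [C], so would the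
    weighted mean. *)
Lemma convex_combination_min (w F : 'I_p -> R) (C : R) :
  (forall j, 0 <= w j) -> \sum_j w j = 1 -> \sum_j w j * F j <= C ->
  exists j, F j <= C.
Proof.
move=> w0 w1 wF; apply/existsP; apply: contraT => /existsPn nF.
have F_gt j : C < F j by rewrite ltNge.
have s0 : \sum_j w j * (F j - C) == 0.
  rewrite eq_le sumr_ge0 ?andbT; last first.
    by move=> j _; rewrite mulr_ge0// subr_ge0 ltW.
  under eq_bigr do rewrite mulrBr.
  by rewrite sumrB -mulr_suml w1 mul1r subr_le0.
move: s0; rewrite psumr_eq0; last first.
  by move=> j _; rewrite mulr_ge0// subr_ge0 ltW.
move=> /allP w00; move: w1; rewrite big1 => [/eqP|j _].
  by rewrite eq_sym oner_eq0.
have := w00 j; rewrite mem_index_enum => /(_ isT); rewrite mulf_eq0.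
by rewrite (gt_eqF (_ : 0 < F j - C)) ?orbF ?subr_gt0// => /eqP.
Qed.

(* Drawing the signed coordinate vectors at random with mean [x], one at a time,
   the conditional expectation of the quadratic form can be kept from
   increasing. *)
Lemma signed_sum_le A x u d : norm1 x = 1 ->
  exists2 f : seq ('I_p * bool), size f = d &
    qform A (u + signed_sum f) <= qform A (u + d%:R *: x) +
      d%:R * (\sum_j `|x j 0| * A j j - qform A x).
Proof.
move=> x1; set V := _ - qform A x.
elim: d u => [|d IH] u.
  exists [::]; first by [].
  by rewrite /signed_sum big_nil scale0r mul0r !addr0.
(* Drawn with probability [|x j 0|], the vector [Z j] has mean [x], while [qform A (Z j) = A j j]
   whatever the sign. Thus [V] is the mean of the form minus the form of the mean, the price of one
   draw. *)
pose Z j := signed_delta (j, x j 0 < 0).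
have : exists j, qform A (u + Z j + d%:R *: x) + d%:R * V <=
    qform A (u + d.+1%:R *: x) + d.+1%:R * V.
  apply: (convex_combination_min (w := fun j => `|x j 0|)) => //.
  set y := u + d%:R *: x.
  have ZxE j : `|x j 0| *: Z j = x j 0 *: delta_mx j 0.
    by rewrite scalerA mulrC -numEsign.
  have Zx : \sum_j `|x j 0| *: Z j = x.
    rewrite [RHS]matrix_sum_delta; apply: eq_bigr => j _.
    by rewrite ZxE big_ord1.
  have qZ j : qform A (Z j) = A j j by rewrite qformZ sqrr_sign mul1r qform_delta.
  have -> : u + d.+1%:R *: x = y + x.
    by rewrite -natr1 scalerDl scale1r addrA.
  rewrite (eq_bigr (fun j => `|x j 0| * (qform A y + d%:R * V) +
     dotv y (A *m (`|x j 0| *: Z j)) + dotv (`|x j 0| *: Z j) (A *m y) +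
     `|x j 0| * A j j)); last first.
    move=> j _; rewrite addrAC -/y qformD qZ; clearbody Z.
    by rewrite -scalemxAr dotvZl dotvZr; ring.
  rewrite !big_split /= -mulr_suml -/(norm1 x) x1 mul1r.
  rewrite -dotv_sumr -mulmx_sumr Zx.
  under [X in _ + X + _]eq_bigr do rewrite dotvC.
  rewrite -dotv_sumr Zx qformD /V -natr1 (dotvC (A *m y)).
  by lra.
move=> [j Hj]; have [f fd Hf] := IH (u + Z j).
exists ((j, x j 0 < 0) :: f); first by rewrite /= fd.
by rewrite /signed_sum big_cons addrA; exact: le_trans Hf Hj.
Qed.

(** For |x|_1 = 1, a suitable sum of d + 1 terms gives 0 <= (d + 1)^2 q + (d + 1) (S - q) = (d + 1)
    (d q + S) with q = [qform A x] and S <= M. The [- q] in the price of a draw turns d + 1 into d,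
    hence tuples of length [d.+1]. *)
Lemma transfer_principle A (d : nat) (M : R) : (0 < d)%N -> 0 <= M ->
  (forall j, A j j <= M) ->
  (forall f : d.+1.-tuple ('I_p * bool), 0 <= qform A (signed_sum f)) ->
  forall x, - (M / d%:R * norm1 x ^+ 2) <= qform A x.
Proof.
move=> d0 M0 AM Af x.
have d0' : 0 < d%:R :> R by rewrite ltr0n.
have [->|x0] := eqVneq x 0.
  rewrite qformE mulmx0 /dotv mulmx0 mxE oppr_le0 mulr_ge0 ?sqr_ge0//.
  by rewrite divr_ge0// ltW.
have n0 : norm1 x != 0 by rewrite norm1_eq0.
set y := (norm1 x)^-1 *: x.
have xE : x = norm1 x *: y by rewrite scalerA mulfV// scale1r.
have y1 : norm1 y = 1 by rewrite norm1Z ger0_norm ?invr_ge0 ?norm1_ge0// mulVf.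
suff qy : - (M / d%:R) <= qform A y.
  rewrite xE qformZ norm1Z y1 mulr1 (ger0_norm (norm1_ge0 _)).
  by rewrite mulrC -mulrN ler_wpM2l ?sqr_ge0.
have [f fd] := @signed_sum_le A y 0 d.+1 y1.
have -> : f = in_tuple f by [].
move: (in_tuple f); rewrite fd => g; rewrite !add0r qformZ => H.
have {}H := le_trans (Af g) H.
have S : \sum_j `|y j 0| * A j j <= M.
  rewrite -[leRHS]mul1r -y1 mulr_suml; apply: ler_sum => j _.
  by rewrite ler_wpM2l.
rewrite lerNl ler_pdivlMr// mulNr lerNl.
have D : 0 < d.+1%:R :> R by rewrite ltr0n.
have {}H : 0 <= d.+1%:R * (d.+1%:R * qform A y + (\sum_j `|y j 0| * A j j - qform A y)).
  by move: H; congr (_ <= _); ring.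
move: H; rewrite pmulr_rge0// -natr1 mulrDl mul1r; lra.
Qed.

End Transfer.

Section Lasso.
Context {R : realType} {p : nat}.
Implicit Types (a alpha m : 'cV[R]_p) (C Sigma : 'M[R]_p).

Lemma dotv_le_norm1 (u v : 'cV[R]_p) (b : R) :
  (forall j, `|u j 0| <= b) -> `|dotv u v| <= b * norm1 v.
Proof.
move=> ub; rewrite dotvE (le_trans (ler_norm_sum _ _ _))// mulr_sumr.
by apply: ler_sum => j _; rewrite normrM ler_wpM2r.
Qed.

(** Cauchy-Schwarz against the indicator vector of the support of [alpha]. *)
Lemma norm1_support_le (u alpha : 'cV[R]_p) (s : nat) : (norm0 alpha <= s)%N ->
  \sum_(j | alpha j 0 != 0) `|u j 0| <= Num.sqrt s%:R * norm2 u.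
Proof.
move=> as_; pose i : 'cV[R]_p := \col_j (alpha j 0 != 0)%:R.
pose v : 'cV[R]_p := \col_j `|u j 0|.
have -> : \sum_(j | alpha j 0 != 0) `|u j 0| = dotv i v.
  by rewrite dotvE big_mkcond; apply: eq_bigr => j _; rewrite !mxE; case: ifP;
     rewrite ?mul1r ?mul0r.
apply: le_trans (ler_norm _) _; apply: le_trans (cauchy_schwarz _ _) _.
have -> : norm2 v = norm2 u.
  by rewrite /norm2; under eq_bigr do rewrite mxE real_normK ?num_real//.
rewrite ler_wpM2r ?norm2_ge0// /norm2 ler_wsqrtr//.
have -> : \sum_j i j 0 ^+ 2 = (norm0 alpha)%:R.
  rewrite /norm0 -sum1_card natr_sum big_mkcond [RHS]big_mkcond.
  by apply: eq_bigr => j _; rewrite !mxE inE; case: eqP; rewrite ?expr0n ?expr1n.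
by rewrite ler_nat.
Qed.

(** The smooth part of the objective has gradient [C *m alpha - m] at [alpha], whose pairing with
    [delta] is at most half of the penalty of [delta]. With S and N the l1 masses of [delta] on and
    off the support of [alpha], this leaves q / 2 + lambda (N - 3 S) / 2 <= 0, where q is the form
    at [delta]. Both claims follow, the first from the cone condition N <= 3 S. *)
Lemma lasso_basic_inequality C m alpha a (lambda : R) (s : nat)
    (delta := a - alpha) :
  C^T = C -> 0 < lambda -> (norm0 alpha <= s)%N ->
  (forall j, `|(C *m alpha - m) j 0| <= lambda / 2) ->
  2^-1 * qform C a - dotv a m + lambda * norm1 a <=
    2^-1 * qform C alpha - dotv alpha m + lambda * norm1 alpha ->
  (forall v, 0 <= qform C v) ->
  norm1 delta <= 4 * (Num.sqrt s%:R * norm2 delta) /\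
  qform C delta <= 3 * lambda * (Num.sqrt s%:R * norm2 delta).
Proof.
move=> sC l0 als h obj C0; set h_ := C *m alpha - m in h.
have hd := dotv_le_norm1 delta h.
have aE : a = alpha + delta by rewrite /delta addrCA subrr addr0.
pose S (v : 'cV[R]_p) := \sum_(j | alpha j 0 != 0) `|v j 0|.
pose N (v : 'cV[R]_p) := \sum_(j | ~~ (alpha j 0 != 0)) `|v j 0|.
have n1 v : norm1 v = S v + N v.
  by rewrite /norm1 (bigID (fun j => alpha j 0 != 0)).
have Na : N alpha = 0.
  by rewrite /N big1// => j; rewrite negbK => /eqP->; rewrite normr0.
have Nd : N a = N delta.
  by apply: eq_bigr => j; rewrite negbK !mxE => /eqP ->; rewrite subr0.
have Sd : S alpha - S delta <= S a.
  rewrite -sumrB; apply: ler_sum => j _.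
  rewrite aE [in leRHS]mxE lerBlDr.
  have -> : alpha j 0 = (alpha j 0 + delta j 0) - delta j 0 by rewrite addrK.
  by rewrite (le_trans (ler_normB _ _))// lerD// subrK.
clearbody delta.
have := norm1_support_le delta als; rewrite -/(S delta) => Sle.
have S0 : 0 <= S delta by exact: sumr_ge0.
have N0 : 0 <= N delta by exact: sumr_ge0.
have key : 2^-1 * qform C delta + dotv h_ delta + lambda * (N delta - S delta) <= 0.
  move: obj; rewrite {1}aE qformD {1}aE dotvDl /h_ dotvDl dotvNl.
  rewrite (dotv_mulmx alpha C delta) sC (dotvC delta (C *m _)) (dotvC delta m).
  rewrite !n1 Na Nd => obj.
  have : lambda * (S alpha - S delta) <= lambda * S a by rewrite ler_wpM2l// ltW.
  lra.
have := C0 delta; move: hd; rewrite ler_norml n1 => /andP[hd _] q0.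
have e : lambda * (N delta - 3 * S delta) <= 0 by nra.
have cone : N delta <= 3 * S delta.
  by rewrite -subr_le0 -(pmulr_rle0 _ l0).
split; first by lra.
have H : lambda * S delta <= lambda * (Num.sqrt s%:R * norm2 delta).
  by rewrite ler_wpM2l// ltW.
have H2 : 0 <= lambda * N delta by rewrite mulr_ge0// ltW.
by rewrite -mulrA; lra.
Qed.

(* [M] stands for a bound on the diagonal of [C] and [d] for the sparsity level
   up to which restricted strong convexity was checked. *)
Lemma lasso_error_bound C Sigma m alpha a (lambda cL M : R) (s d : nat)
    (delta := a - alpha) :
  C^T = C -> 0 < lambda -> (norm0 alpha <= s)%N -> 0 < cL ->
  (forall v, cL * dotv v v <= qform Sigma v) ->
  (forall v, 2^-1 * qform Sigma v - M / d%:R * norm1 v ^+ 2 <= qform C v) ->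
  (0 < d)%N -> 0 <= M -> 64 * M * s%:R <= cL * d%:R ->
  (forall j, `|(C *m alpha - m) j 0| <= lambda / 2) ->
  2^-1 * qform C a - dotv a m + lambda * norm1 a <=
    2^-1 * qform C alpha - dotv alpha m + lambda * norm1 alpha ->
  (forall v, 0 <= qform C v) ->
  norm2 delta ^+ 2 <= 144 / cL ^+ 2 * (lambda ^+ 2 * s%:R) /\
  2 * `|dotv (m - C *m alpha) delta| + qform C delta <=
    84 / cL * (lambda ^+ 2 * s%:R).
Proof.
move=> sC l0 als cL0 Slow RE d0 M0 dbig h obj C0.
have [n1 q] := lasso_basic_inequality sC l0 als h obj C0.
rewrite -/delta in n1 q; clearbody delta.
have n1sq : norm1 delta ^+ 2 <= 16 * s%:R * norm2 delta ^+ 2.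
  have -> : 16 * s%:R * norm2 delta ^+ 2 = (4 * (Num.sqrt s%:R * norm2 delta)) ^+ 2.
    rewrite !exprMn (sqr_sqrtr (ler0n _ _)); ring.
  by rewrite ler_sqr// nnegrE ?norm1_ge0// !mulr_ge0 ?sqrtr_ge0 ?norm2_ge0.
have d0' : 0 < d%:R :> R by rewrite ltr0n.
(* By the cone bound and [64 * M * s <= cL * d], the l1 correction is at most cL / 4 times
   |delta|^2, half of the curvature cL / 2. *)
have RE' : cL / 4 * norm2 delta ^+ 2 <= qform C delta.
  apply: le_trans (RE delta).
  have := Slow delta; rewrite -norm2_sqr => S1.
  have Md : 0 <= M / d%:R by rewrite divr_ge0// ltW.
  have : M / d%:R * norm1 delta ^+ 2 <= M / d%:R * (16 * s%:R * norm2 delta ^+ 2).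
    by rewrite ler_wpM2l.
  have : M / d%:R * (16 * s%:R * norm2 delta ^+ 2) <= cL / 4 * norm2 delta ^+ 2.
    rewrite [leLHS]mulrA ler_wpM2r ?sqr_ge0//.
    have -> : M / d%:R * (16 * s%:R) = (64 * M * s%:R) / 4 / d%:R.
      by field; rewrite gt_eqF.
    by rewrite ler_pdivrMr// [leRHS]mulrAC ler_pM2r// invr_gt0.
  lra.
have D : norm2 delta <= 12 * lambda * Num.sqrt s%:R / cL.
  have [->|e0] := eqVneq (norm2 delta) 0.
    by rewrite !mulr_ge0 ?invr_ge0 ?sqrtr_ge0 ?ltW.
  have e1 : 0 < norm2 delta by rewrite lt_neqAle eq_sym e0 norm2_ge0.
  rewrite ler_pdivlMr// -(ler_pM2r e1).
  by have := le_trans RE' q; rewrite expr2; lra.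
have lam0 := ltW l0.
split.
  have -> : 144 / cL ^+ 2 * (lambda ^+ 2 * s%:R) =
      (12 * lambda * Num.sqrt s%:R / cL) ^+ 2.
    rewrite !exprMn (sqr_sqrtr (ler0n _ _)) exprVn; ring.
  rewrite ler_sqr// nnegrE ?norm2_ge0//.
  by rewrite !mulr_ge0 ?invr_ge0 ?sqrtr_ge0 ?ltW.
have hd : `|dotv (m - C *m alpha) delta| <= lambda / 2 * norm1 delta.
  by rewrite -opprB dotvNl normrN; exact: dotv_le_norm1.
have : lambda / 2 * norm1 delta <= lambda / 2 * (4 * (Num.sqrt s%:R * norm2 delta)).
  by rewrite ler_wpM2l// divr_ge0.
(* 7 = 4 + 3: the gradient term contributes lambda |delta|_1, at most 4 lambda sqrt s |delta|_2, and
   the form contributes 3 lambda sqrt s |delta|_2. Then 84 = 7 * 12. *)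
have : 7 * lambda * Num.sqrt s%:R * norm2 delta <=
    7 * lambda * Num.sqrt s%:R * (12 * lambda * Num.sqrt s%:R / cL).
  by rewrite ler_wpM2l// !mulr_ge0 ?sqrtr_ge0.
have -> : 7 * lambda * Num.sqrt s%:R * (12 * lambda * Num.sqrt s%:R / cL) =
    84 / cL * (lambda ^+ 2 * Num.sqrt s%:R ^+ 2) by ring.
rewrite (sqr_sqrtr (ler0n _ _)); lra.
Qed.

End Lasso.

(** * Products of independent random variables *)

Section IndependentProduct.
Context {R : realType} d (T : measurableType d) (P : probability T R).
Import HBNNSimple.

Lemma integral_mul_simple (H U : T -> R) (f : {nnsfun R >-> R}) :
  measurable_fun [set: T] H -> (forall w, 0 <= H w) -> measurable_fun [set: T] U ->
  (\int[P]_w (H w * f (U w))%:E = \sum_(k \in range f)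
    (k%:E * \int[P]_w (H w * \1_(f @^-1` [set k]) (U w))%:E))%E.
Proof.
move=> mH H0 mU.
have m1 k : measurable_fun [set: T] (fun w => H w * \1_(f @^-1` [set k]) (U w)).
  apply: measurable_funM => //.
  by apply: measurableT_comp => //; exact: measurable_indic.
have ge0 k w : (0 <= (k * (H w * \1_(f @^-1` [set k]) (U w)))%:E)%E.
  rewrite mulrCA EFinM mule_ge0 ?lee_fin//.
  by have := nnfun_muleindic_ge0 f k (U w); rewrite -EFinM lee_fin.
transitivity (\int[P]_w (\sum_(k \in range f)
    (k * (H w * \1_(f @^-1` [set k]) (U w)))%:E))%E.
  apply: eq_integral => w _; rewrite fimfunE fsumEFin//; congr EFin.
  by rewrite mulr_fsumr//; apply: eq_fsbigr => k _; ring.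
rewrite ge0_integral_fsum//.
  apply: eq_fsbigr => k; rewrite inE => -[r _ <-].
  under eq_integral do rewrite EFinM.
  rewrite ge0_integralZl_EFin//.
  + by move=> w _; rewrite lee_fin mulr_ge0.
  + by apply/measurable_EFinP.
by move=> k; apply/measurable_EFinP; exact: measurable_funM.
Qed.

(* [c] is the mean of [H]; the hypothesis says that [H] is uncorrelated with all
   events generated by [U]. *)
Lemma integral_mul_indep (H U : T -> R) (c : R) :
  measurable_fun [set: T] H -> (forall w, 0 <= H w) ->
  measurable_fun [set: T] U -> (forall w, 0 <= U w) -> 0 <= c ->
  (forall A : set R, measurable A ->
    (\int[P]_w (H w * \1_A (U w))%:E = c%:E * P (U @^-1` A))%E) ->
  (\int[P]_w (H w * U w)%:E = c%:E * \int[P]_w (U w)%:E)%E.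
Proof.
move=> mH H0 mU U0 c0 HU.
(* The approximating simple functions live on the line and are composed with [U], so that their
   level sets are events generated by [U]. The absolute value gives a target that is nonnegative
   everywhere and equals the identity on the values of [U]. *)
have mf : measurable_fun [set: R] (EFin \o (fun r : R => `|r|)).
  by apply/measurable_EFinP; exact: normr_measurable.
pose f_ := nnsfun_approx measurableT mf.
have mfU n : measurable_fun [set: T] (fun w => f_ n (U w)).
  by apply: measurableT_comp => //; exact: measurable_funP.
have fU w : (f_ n (U w))%:E @[n --> \oo] --> (U w)%:E.
  have h : forall x : R, [set: R] x -> (0 <= (`|x|%R)%:E)%E.
    by move=> x _; rewrite lee_fin.
  have := @cvg_nnsfun_approx _ _ _ _ measurableT _ mf h (U w) Logic.I.
  by rewrite /= ger0_norm.
have nd w : {homo (fun n => f_ n (U w)) : n m / (n <= m)%N >-> n <= m}.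
  by move=> n m nm; exact/lefP/nd_nnsfun_approx.
transitivity (limn (fun n => \int[P]_w (H w * f_ n (U w))%:E))%E.
  rewrite -monotone_convergence//.
  - apply: eq_integral => w _; apply/esym/cvg_lim => //.
    under eq_fun do rewrite EFinM.
    by rewrite EFinM; apply: cvgeZl.
  - by move=> n; apply/measurable_EFinP; exact: measurable_funM.
  - by move=> n w _; rewrite lee_fin mulr_ge0.
  - by move=> w _ n m nm; rewrite lee_fin ler_wpM2l// nd.
transitivity (limn (fun n => \int[P]_w (c%:E * (f_ n (U w))%:E)))%E; last first.
  rewrite -monotone_convergence//.
  - rewrite -ge0_integralZl//; last 2 first.
    + exact/measurable_EFinP.
    + by move=> w _; rewrite lee_fin.
    apply: eq_integral => w _; apply/cvg_lim => //.
    by apply: cvgeZl.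
  - by move=> n; apply: measurable_funeM; exact/measurable_EFinP.
  - by move=> n w _; rewrite mule_ge0// lee_fin.
  - by move=> w _ n m nm; rewrite lee_wpmul2l// lee_fin nd.
congr (limn _); apply/funext => n.
rewrite integral_mul_simple// ge0_integralZl_EFin//; last 2 first.
- by move=> w _; rewrite lee_fin.
- exact/measurable_EFinP.
have m1 : measurable_fun [set: T] (fun=> 1 : R) by exact: measurable_cst.
have -> : (\int[P]_w (f_ n (U w))%:E = \sum_(k \in range (f_ n))
    (k%:E * \int[P]_w (1 * \1_(f_ n @^-1` [set k]) (U w))%:E))%E.
  rewrite -(integral_mul_simple (f_ n) m1 (fun=> ler01) mU).
  by apply: eq_integral => w _; rewrite mul1r.
rewrite ge0_mule_fsumr; last first.
  move=> k; have [k0|k0] := ltP k 0.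
    by rewrite preimage_nnfun0// indic0; under eq_integral do rewrite /= mulr0;
       rewrite integral0 mule0.
  by rewrite mule_ge0 ?lee_fin// integral_ge0// => w _; rewrite mul1r lee_fin.
apply: eq_fsbigr => k _; rewrite muleCA; congr (_ * _)%E.
have mA : measurable (f_ n @^-1` [set k]) by exact: measurable_sfunP.
rewrite HU//; congr (_ * _)%E.
have mUA : measurable (U @^-1` (f_ n @^-1` [set k])).
  by rewrite -[X in measurable X]setTI; exact: mU.
transitivity (\int[P]_w (\1_(U @^-1` (f_ n @^-1` [set k])) w)%:E)%E.
  by rewrite integral_indic// setIT.
by apply: eq_integral => w _; rewrite mul1r !indicE.
Qed.

(* Induction on the number [k] of indices at which [U i] appears itself, the
   other factors being indicators of events. *)
Lemma independent_integral_prod (n : nat) (U : 'I_n -> T -> R) (e : 'I_n -> R) :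
  (forall i, measurable_fun [set: T] (U i)) -> (forall i w, 0 <= U i w) ->
  (forall A : 'I_n -> set R, (forall i, measurable (A i)) ->
    (P [set w | forall i, A i (U i w)] = \prod_(i < n) P (U i @^-1` A i))%E) ->
  (forall i, \int[P]_w (U i w)%:E = (e i)%:E)%E ->
  (\int[P]_w (\prod_(i < n) U i w)%:E = (\prod_(i < n) e i)%:E)%E.
Proof.
move=> mU U0 indep eU.
have e0 i : 0 <= e i.
  by rewrite -lee_fin -eU; apply: integral_ge0 => w _; rewrite lee_fin.
have mUA i A : measurable A -> measurable (U i @^-1` A).
  by move=> mA; rewrite -[X in measurable X]setTI; exact: mU.
have PE i A : measurable A -> P (U i @^-1` A) = (fine (P (U i @^-1` A)))%:E.
  by move=> mA; rewrite fineK// fin_num_measure//; exact: mUA.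
suff H k (A : 'I_n -> set R) : (forall i, measurable (A i)) ->
    (\int[P]_w (\prod_(i < n) (if (i < k)%N then U i w else \1_(A i) (U i w)))%:E
      = (\prod_(i < n) (if (i < k)%N then e i else fine (P (U i @^-1` A i))))%:E)%E.
  have := H n (fun=> setT) (fun=> measurableT).
  under eq_integral do under eq_bigr do rewrite ltn_ord.
  by under eq_bigr do rewrite ltn_ord.
elim: k A => [|k IH] A mA.
  rewrite -prodEFin.
  transitivity (P [set w | forall i, A i (U i w)]); last first.
    by rewrite indep//; apply: eq_bigr => i _; rewrite PE.
  have mA' : measurable [set w | forall i, A i (U i w)].
    rewrite (_ : [set w | _] = \bigcap_(i in [set: 'I_n]) (U i @^-1` A i)).
      by apply: fin_bigcap_measurable => //= i _; exact: mUA.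
    by apply/seteqP; split => w /= h i; [move=> _|]; exact: h.
  transitivity (\int[P]_w (\1_[set w | forall i, A i (U i w)] w)%:E)%E; last first.
    by rewrite integral_indic// setIT.
  apply: eq_integral => w _; rewrite indicE; congr EFin.
  have [h|h] := boolP (w \in [set w | forall i, A i (U i w)]).
    move: h; rewrite inE => h.
    by rewrite big1// => i _; rewrite indicE mem_set//; exact: h.
  have [i Hi] : exists i, ~ A i (U i w).
    by apply/existsNP => Hw; move: h; rewrite notin_setE; apply.
  rewrite (bigD1 i)//= indicE memNset// mul0r//.
have [kn|nk] := ltnP k n; last first.
  have lt (i : 'I_n) : ((i < k.+1)%N = (i < k)%N).
    by rewrite !(leq_trans (ltn_ord i))// ltnW.
  have := IH A mA.
  under eq_integral do under eq_bigr do rewrite -lt.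
  by under eq_bigr do rewrite -lt.
pose j := Ordinal kn.
have ltj (i : 'I_n) : i != j -> ((i < k.+1)%N = (i < k)%N).
  by move=> ij; rewrite ltnS leq_eqVlt -[(i == k :> nat)]/(i == j) (negbTE ij).
pose H w := \prod_(i < n | i != j) (if (i < k)%N then U i w else \1_(A i) (U i w)).
pose c := \prod_(i < n | i != j) (if (i < k)%N then e i else fine (P (U i @^-1` A i))).
have indic_ge0 (B : set R) r : 0 <= \1_B r :> R by rewrite indicE.
have -> : \prod_(i < n) (if (i < k.+1)%N then e i else fine (P (U i @^-1` A i)))
    = c * e j.
  rewrite (bigD1 j)//= ltnSn mulrC; congr (_ * _).
  by apply: eq_bigr => i ij; rewrite ltj.
rewrite EFinM -eU -(@integral_mul_indep H (U j) c).
- apply: eq_integral => w _; rewrite (bigD1 j)//= ltnSn mulrC; congr (_ * _)%:E.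
  by apply: eq_bigr => i ij; rewrite ltj.
- rewrite /H; under eq_fun do rewrite big_mkcond.
  apply: measurable_prod => i _; case: (i != j) => //.
  case: (i < k)%N => //.
  by apply: measurableT_comp => //; exact: measurable_indic.
- by move=> w; apply: prodr_ge0 => i _; case: ifP.
- exact: mU.
- exact: U0.
- apply: prodr_ge0 => i _; case: ifP => // _; exact: fine_ge0.
(* The required uncorrelatedness is the induction hypothesis itself, with the event at index [j]
   replaced by [B]. *)
- move=> B mB; pose A' i := if i == j then B else A i.
  have mA' i : measurable (A' i) by rewrite /A'; case: ifP.
  have -> : (c%:E * P (U j @^-1` B) = (\prod_(i < n)
      (if (i < k)%N then e i else fine (P (U i @^-1` A' i))))%:E)%E.
    rewrite (bigD1 j)//= ltnn {1}/A' eqxx [in RHS]mulrC EFinM -PE//.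
    congr (_ %:E * _)%E; apply: eq_bigr => i ij.
    by rewrite /A' (negbTE ij).
  rewrite -IH//.
  apply: eq_integral => w _; rewrite [in RHS](bigD1 j)//= ltnn {1}/A' eqxx mulrC.
  by congr (_ * _)%:E; apply: eq_bigr => i ij; rewrite /A' (negbTE ij).
Qed.

End IndependentProduct.

(** * Moment generating functions *)

Section MeanBounds.
Context {R : realType} d (T : measurableType d) (P : probability T R).
Implicit Types (f g W X : T -> R) (a e : R).

(** Measurability and nonnegativity are bundled with the bound, so that such bounds can be added,
    scaled and multiplied without side conditions on integrability. *)
Definition mean_le f e : Prop :=
  [/\ measurable_fun [set: T] f, forall w, 0 <= f w & (\int[P]_w (f w)%:E <= e%:E)%E].

Lemma mean_le_cst a : 0 <= a -> mean_le (fun=> a) a.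
Proof.
move=> a0; split=> //.
by rewrite (integral_cst P)//= probability_setT mule1.
Qed.

Lemma mean_leD f g e e' : mean_le f e -> mean_le g e' ->
  mean_le (fun w => f w + g w) (e + e').
Proof.
move=> [mf f0 fe] [mg g0 ge]; split; first exact: measurable_funD.
  by move=> w; rewrite addr_ge0.
under eq_integral do rewrite EFinD.
rewrite ge0_integralD//; do ?[exact/measurable_EFinP|by move=> w _; rewrite lee_fin].
by rewrite EFinD leeD.
Qed.

Lemma mean_leZ f a e : 0 <= a -> mean_le f e -> mean_le (fun w => a * f w) (a * e).
Proof.
move=> a0 [mf f0 fe]; split; first exact: measurable_funM.
  by move=> w; rewrite mulr_ge0.
under eq_integral do rewrite EFinM.
rewrite ge0_integralZl_EFin//; first by rewrite EFinM lee_wpmul2l// lee_fin.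
  by move=> w _; rewrite lee_fin.
exact/measurable_EFinP.
Qed.

Lemma mean_le_sum (I : Type) (r : seq I) (F : I -> T -> R) (e : I -> R) :
  (forall i, mean_le (F i) (e i)) ->
  mean_le (fun w => \sum_(i <- r) F i w) (\sum_(i <- r) e i).
Proof.
move=> Fe; elim: r => [|i r IH].
  rewrite big_nil; under [X in mean_le X]eq_fun do rewrite big_nil.
  exact: mean_le_cst.
rewrite big_cons; under [X in mean_le X]eq_fun do rewrite big_cons.
exact: mean_leD.
Qed.

Lemma mean_le_dom f g e : mean_le g e -> measurable_fun [set: T] f ->
  (forall w, 0 <= f w <= g w) -> mean_le f e.
Proof.
move=> [mg g0 ge] mf fg; split=> // [w|]; first by case/andP: (fg w).
apply: le_trans ge; apply: ge0_le_integral => //.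
- by move=> w _; rewrite lee_fin; case/andP: (fg w).
- exact/measurable_EFinP.
- exact/measurable_EFinP.
- by move=> w _; rewrite lee_fin; case/andP: (fg w).
Qed.

Lemma mean_leW f e e' : e <= e' -> mean_le f e -> mean_le f e'.
Proof. by move=> ee [mf f0 fe]; split=> //; rewrite (le_trans fe)// lee_fin. Qed.

Lemma mean_le_integrable f e : mean_le f e -> P.-integrable [set: T] (EFin \o f).
Proof.
move=> [mf f0 fe]; apply/integrableP; split; first exact/measurable_EFinP.
under eq_integral => w _ do rewrite /= ger0_norm//.
by rewrite (le_lt_trans fe)// ltry.
Qed.

Lemma mean_le_integrable_norm W f e : mean_le f e -> measurable_fun [set: T] W ->
  (forall w, `|W w| <= f w) -> P.-integrable [set: T] (EFin \o W).
Proof.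
move=> fe mW Wf; apply: le_integrable (mean_le_integrable fe) => //.
  exact/measurable_EFinP.
by move=> w _ /=; rewrite lee_fin (le_trans (Wf w))// ler_norm.
Qed.

Lemma mean_le_prod (n : nat) (U : 'I_n -> T -> R) (e : 'I_n -> R) :
  (forall i, mean_le (U i) (e i)) ->
  (forall A : 'I_n -> set R, (forall i, measurable (A i)) ->
    (P [set w | forall i, A i (U i w)] = \prod_(i < n) P (U i @^-1` A i))%E) ->
  mean_le (fun w => \prod_(i < n) U i w) (\prod_(i < n) e i).
Proof.
move=> Ue indep; split.
- by apply: measurable_prod => i _; case: (Ue i).
- by move=> w; apply: prodr_ge0 => i _; case: (Ue i).
have Ufin i : (\int[P]_w (U i w)%:E = (fine (\int[P]_w (U i w)%:E))%:E)%E.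
  have [mU U0 Ui] := Ue i; rewrite fineK// ge0_fin_numE.
    by rewrite (le_lt_trans Ui)// ltry.
  by apply: integral_ge0 => w _; rewrite lee_fin.
rewrite (independent_integral_prod _ _ indep Ufin).
- rewrite lee_fin; apply: ler_prod => i _; have [mU U0 Ui] := Ue i.
  rewrite -!lee_fin -Ufin Ui andbT.
  by apply: integral_ge0 => w _; rewrite lee_fin.
- by move=> i; case: (Ue i).
- by move=> i; case: (Ue i).
Qed.

(** Everything comes from [expR x * (1 - x) <= 1]. For [x >= 0] it is used twice, as e^x <= 1 + x
    e^x and as x e^x <= x + x^2 e^x; for [x < 0] it is compared with (1 + x + x^2) (1 - x) = 1 - x^3
    >= 1. *)
Lemma expR_le_quadratic (x : R) : expR x <= 1 + x + x ^+ 2 * expR `|x|.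
Proof.
have h : expR x * (1 - x) <= 1.
  have := expR_ge1Dx (- x); rewrite -(ler_pM2l (expR_gt0 x)).
  by rewrite -expRD subrr expR0.
have e0 := expR_gt0 x.
have h1 := expR_ge1Dx x.
have [x0|x0] := leP 0 x.
  by rewrite ger0_norm// expr2; nra.
have h2 : 1 <= expR `|x| by rewrite -expR0 ler_expR.
by rewrite expr2; nra.
Qed.

(** In the quadratic bound for exp (a W) the linear term has mean 0. In the remainder, W^2 <= 16 K^2
    exp (|W| / 2K), from x <= e^x at x = |W| / 4K, and exp |a W| <= exp (|W| / 2K) by the
    restriction on [a]; their product involves only exp (|W| / K), of mean at most [C]. *)
Lemma mgf_le W (K C a : R) : 0 < K -> measurable_fun [set: T] W ->
  mean_le (fun w => expR (`|W w| / K)) C -> (\int[P]_w (W w)%:E = 0)%E ->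
  `|a| <= (2 * K)^-1 ->
  mean_le (fun w => expR (a * W w)) (expR (16 * K ^+ 2 * C * a ^+ 2)).
Proof.
move=> K0 mW GC W0 aK.
pose G w := expR (`|W w| / K).
have mE : measurable_fun [set: T] (fun w => expR (a * W w)).
  by apply: measurableT_comp => //; exact: measurable_funM.
split; [exact: mE|by move=> w; exact: expR_ge0|].
have x_exp (x : R) : x <= expR x by apply: le_trans (expR_ge1Dx x); rewrite lerDr.
have WK w : `|W w| <= K * G w.
  by rewrite mulrC -ler_pdivrMr.
have iW : P.-integrable [set: T] (EFin \o W).
  by apply: mean_le_integrable_norm mW WK; apply: mean_leZ GC; exact: ltW.
have iG := mean_le_integrable GC.
have bound w : expR (a * W w) <= (1 + a * W w) + 16 * K ^+ 2 * a ^+ 2 * G w.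
  apply: le_trans (expR_le_quadratic _) _; rewrite lerD2l.
  have -> : 16 * K ^+ 2 * a ^+ 2 * G w = (a ^+ 2) * (16 * K ^+ 2 * G w) by ring.
  rewrite exprMn -[leLHS]mulrA ler_wpM2l ?sqr_ge0//.
  have W2 : W w ^+ 2 <= 16 * K ^+ 2 * expR (`|W w| / (2 * K)).
    rewrite -real_normK ?num_real//.
    set x := `|W w| / (4 * K).
    have -> : `|W w| = 4 * K * x by rewrite /x; field; rewrite gt_eqF.
    have -> : 4 * K * x / (2 * K) = x + x by field; rewrite gt_eqF.
    have x0 : 0 <= x by rewrite divr_ge0// mulr_ge0// ltW.
    have -> : (4 * K * x) ^+ 2 = 16 * K ^+ 2 * x ^+ 2 by ring.
    apply: ler_wpM2l; first by rewrite mulr_ge0// sqr_ge0.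
    by rewrite expRD expr2 ler_pM.
  have aW : expR `|a * W w| <= expR (`|W w| / (2 * K)).
    by rewrite ler_expR normrM mulrC ler_wpM2l.
  apply: le_trans (ler_pM (sqr_ge0 _) (expR_ge0 _) W2 aW) _.
  rewrite -[leLHS]mulrA -expRD /G.
  have -> // : `|W w| / (2 * K) + `|W w| / (2 * K) = `|W w| / K.
  by field; rewrite gt_eqF.
apply: (@le_trans _ _ (\int[P]_w ((1 + a * W w) + 16 * K ^+ 2 * a ^+ 2 * G w)%:E)%E).
  apply: ge0_le_integral => //.
  - exact/measurable_EFinP.
  - apply/measurable_EFinP; apply: measurable_funD.
      by apply: measurable_funD => //; exact: measurable_funM.
    by apply: measurable_funM => //; case: GC.
  - by move=> w _; rewrite lee_fin bound.
under eq_integral do rewrite EFinD EFinD !EFinM.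
have i1 : P.-integrable [set: T] (fun=> 1%:E).
  exact: (finite_measure_integrable_cst _ 1).
have iaW : P.-integrable [set: T] (fun w => (a%:E * (W w)%:E)%E).
  exact: integrableZl.
rewrite integralD//; last 2 first.
- exact: integrableD.
- by under eq_fun do rewrite -!EFinM; under eq_fun do rewrite EFinM; exact: integrableZl.
have P1 : (\int[P]_w (1%:E : \bar R) = 1)%E.
  by rewrite integral_cst//= probability_setT mule1.
rewrite integralD// P1 integralZl// W0 mule0 adde0.
under eq_integral do rewrite -!EFinM EFinM.
rewrite integralZl//; case: GC => _ _ GC.
apply: (@le_trans _ _ (1 + (16 * K ^+ 2 * a ^+ 2)%:E * C%:E)%E).
  rewrite leeD2l// lee_wpmul2l// lee_fin.
  by apply: mulr_ge0; [apply: mulr_ge0 => //|]; exact: sqr_ge0.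
rewrite -EFinM -EFinD lee_fin; apply: le_trans (expR_ge1Dx _).
by rewrite lerD2l le_eqVlt; apply/orP; left; apply/eqP; ring.
Qed.

(* [expR (X^2 / (2 nu^2))] is at most [expR ((k + 1) / 2)] on the shell
   [k <= X^2 / nu^2 < k + 1], whose probability is at most [2 expR (- k)]. *)
Lemma subgaussian_exp_moment X (nu : R) : 0 < nu -> measurable_fun [set: T] X ->
  (forall t, 0 <= t ->
    (P [set w | (t <= `|X w|)%R] <= (2 * expR (- (t ^+ 2 / nu ^+ 2)))%:E)%E) ->
  mean_le (fun w => expR (X w ^+ 2 / (2 * nu ^+ 2)))
    (2 * expR (2^-1) / (1 - expR (- 2^-1))).
Proof.
move=> nu0 mX tail; split.
- apply: measurableT_comp => //; apply: measurable_funM => //.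
  exact: measurable_funX.
- by move=> w; exact: expR_ge0.
set q := expR (- 2^-1); have q0 : 0 < q := expR_gt0 _.
have q1 : q < 1 by rewrite -expR0 ltr_expR oppr_lt0 invr_gt0.
pose A k := [set w | (nu * Num.sqrt k%:R <= `|X w|)%R].
have mA k : measurable (A k).
  rewrite -[X in measurable X]setTI.
  have -> : A k = (fun w => `|X w|) @^-1` `[nu * Num.sqrt k%:R, +oo[%classic.
    by apply/seteqP; split => w /=; rewrite in_itv/= andbT.
  exact: (measurableT_comp (@normr_measurable _ _) mX).
pose u k : R := expR (k.+1%:R / 2).
have u0 k : 0 <= u k by exact: expR_ge0.
have Au0 k w : (0%R <= (u k * \1_(A k) w)%:E)%E.
  by rewrite lee_fin mulr_ge0// indicE.
have mAu k : measurable_fun [set: T] (fun w => (u k * \1_(A k) w)%:E).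
  by apply/measurable_EFinP; apply: measurable_funM => //; exact: measurable_indic.
apply: (@le_trans _ _ (\int[P]_w (\sum_(0 <= k <oo) (u k * \1_(A k) w)%:E))%E).
  apply: ge0_le_integral => //.
  - apply/measurable_EFinP; apply: measurableT_comp => //.
    by apply: measurable_funM => //; exact: measurable_funX.
  - exact: ge0_emeasurable_sum.
  (* The shell containing [w] is indexed by [k], and the [k]-th term of the series alone dominates.
     Using the nested tails [A k] in place of the shells only enlarges the sum. *)
  move=> w _; pose k := Num.truncn (X w ^+ 2 / nu ^+ 2).
  have /andP[k1 k2] : k%:R <= X w ^+ 2 / nu ^+ 2 < k.+1%:R.
    by apply: truncn_itv; rewrite divr_ge0 ?sqr_ge0.
  apply: le_trans (nneseries_lim_ge k.+1 _); last by move=> ? _.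
  rewrite big_nat_recr//= -[leLHS]add0e leeD//.
    by apply: sume_ge0 => i _.
  rewrite indicE mem_set ?mulr1.
    rewrite lee_fin ler_expR invfM mulrA mulrAC ler_wpM2r ?invr_ge0//.
    exact: ltW.
  rewrite /A /= -ler_sqr ?nnegrE ?mulr_ge0 ?sqrtr_ge0 ?(ltW nu0)//.
  rewrite exprMn sqr_sqrtr// real_normK ?num_real// mulrC.
  by rewrite -ler_pdivlMr// exprn_gt0.
rewrite integral_nneseries//.
apply: lime_le; first by apply: is_cvg_nneseries => k _ _; exact: integral_ge0.
apply: nearW => n.
(* Geometric terms: exp ((k + 1) / 2) * 2 exp (- k) = 2 exp (1/2) q^k. *)
apply: (@le_trans _ _ (\sum_(0 <= k < n) (2 * expR 2^-1 * q ^+ k)%:E)%E).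
  apply: lee_sum => k _; under eq_integral do rewrite EFinM.
  rewrite ge0_integralZl_EFin//; last first.
    by apply/measurable_EFinP; exact: measurable_indic.
  rewrite integral_indic// setIT.
  apply: (@le_trans _ _ ((u k)%:E * (2 * expR (- k%:R))%:E)%E).
    rewrite lee_wpmul2l ?lee_fin//.
    have := tail (nu * Num.sqrt k%:R); rewrite exprMn sqr_sqrtr//.
    rewrite mulrAC mulfV ?mul1r; last by rewrite sqrf_eq0 gt_eqF.
    by apply; rewrite mulr_ge0 ?sqrtr_ge0// ltW.
  rewrite -EFinM lee_fin /u /q -expRM_natl mulrCA -mulrA -!expRD.
  rewrite ler_wpM2l// ler_expR -natr1; lra.
rewrite sumEFin lee_fin -mulr_sumr.
rewrite ler_wpM2l ?mulr_ge0 ?expR_ge0//.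
have -> : \sum_(0 <= k < n) q ^+ k = (1 - q ^+ n) / (1 - q).
  have := @geometric_seriesE _ 1 q; rewrite lt_eqF// => /(_ isT)/(congr1 (fun f : nat -> R => f n)).
  by rewrite /series /= mul1r => <-; apply: eq_bigr => k _; rewrite mul1r.
rewrite ler_pdivrMr ?subr_gt0// mulVf; last by rewrite gt_eqF// subr_gt0.
by rewrite gerBl exprn_ge0// ltW.
Qed.

End MeanBounds.

(** * Borel sets of R^p and moments of subgaussian vectors *)

Section BorelVectors.
Context {R : realType} {p : nat}.

(** The system generating [borel_vec], made explicit so that R^p becomes a measurable type and
    random vectors can be composed with measurable functions. *)
Definition borel_generators : set (set 'cV[R]_p) :=
  \big[setU/set0]_(j < p) preimage_set_system [set: 'cV[R]_p]
    (fun v : 'cV[R]_p => v j 0) measurable.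

Local Notation borel_cV := (g_sigma_algebraType borel_generators).

Lemma measurable_coord (j : 'I_p) :
  measurable_fun [set: borel_cV] (fun v : 'cV[R]_p => v j 0).
Proof.
move=> _ A mA; apply: sub_sigma_algebra; rewrite /borel_generators (bigD1 j)//=.
by left; exists A.
Qed.

Lemma measurable_dotv (b : 'cV[R]_p) :
  measurable_fun [set: borel_cV] (fun v : 'cV[R]_p => dotv b v).
Proof.
under eq_fun do rewrite dotvE; apply: measurable_sum => j.
by apply: measurable_funM => //; exact: measurable_coord.
Qed.

Lemma random_vector_measurable d (T : measurableType d) (X : T -> 'cV[R]_p) :
  random_vector X -> measurable_fun [set: T] (X : T -> borel_cV).
Proof.
move=> mX; apply: (@measurability _ _ T borel_cV setT X borel_generators) => //.
move=> _ [B + <-]; rewrite setTI /borel_generators.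
elim/big_rec : _ => // j G _ IH [[A mA <-]|/IH//].
by have := mX j measurableT A mA; rewrite !setTI.
Qed.

End BorelVectors.

Section Moments.
Context {R : realType} {p : nat} d (T : measurableType d) (P : probability T R).
Variables (nu : R) (nu0 : 0 < nu) (y : T -> 'cV[R]_p).
Hypotheses (my : random_vector y) (iso : isotropic_subgaussian P nu y).

(** The first factor pays for the 1 in |x| <= 1 + x^2, and for the 1 bounding |<b1, b2>| when a
    product is centred; one constant thus serves linear forms and products. *)
Definition exp_moment_bound (v : R) : R :=
  expR ((2 * v ^+ 2)^-1) * (2 * expR (2^-1) / (1 - expR (- 2^-1))).

Lemma measurable_dotv_rv (b : 'cV[R]_p) :
  measurable_fun [set: T] (fun w => dotv b (y w)).
Proof.
apply: (measurableT_comp (measurable_dotv b)); exact: random_vector_measurable.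
Qed.

Lemma sqr_exp_moment (b : 'cV[R]_p) : norm2 b = 1 ->
  mean_le P (fun w => expR (dotv b (y w) ^+ 2 / (2 * nu ^+ 2)))
    (2 * expR (2^-1) / (1 - expR (- 2^-1))).
Proof.
move=> b1; apply: subgaussian_exp_moment => //; first exact: measurable_dotv_rv.
by case: iso => _ _ tail t t0; exact: tail.
Qed.

Lemma linear_exp_moment (b : 'cV[R]_p) : norm2 b = 1 ->
  mean_le P (fun w => expR (`|dotv b (y w)| / (2 * nu ^+ 2)))
    (exp_moment_bound nu).
Proof.
move=> b1; have := mean_leZ (expR_ge0 (2 * nu ^+ 2)^-1) (sqr_exp_moment b1).
move=> /mean_le_dom; apply.
  apply: measurableT_comp => //; apply: measurable_funM => //.
  by apply: measurableT_comp => //; exact: measurable_dotv_rv.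
move=> w; rewrite expR_ge0 /=; move: (dotv b (y w)) => U.
set v := 2 * nu ^+ 2; have v0 : 0 < v by rewrite mulr_gt0 ?exprn_gt0.
rewrite -expRD ler_expR -[X in X + _]mul1r -mulrDl ler_pM2r ?invr_gt0//.
rewrite -(real_normK (num_real U)).
by have := sqr_ge0 (`|U| - 1); nra.
Qed.

(** |U V - <b1, b2>| <= 1 + (U^2 + V^2) / 2, and the exponential of a half-sum is at most the
    half-sum of the exponentials, so two squared exponential moments suffice; no independence of U
    and V enters. *)
Lemma product_exp_moment (b1 b2 : 'cV[R]_p) : norm2 b1 = 1 -> norm2 b2 = 1 ->
  mean_le P (fun w => expR (`|dotv b1 (y w) * dotv b2 (y w) - dotv b1 b2| /
    (2 * nu ^+ 2))) (exp_moment_bound nu).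
Proof.
move=> b11 b21.
have h : 0 <= 2^-1 :> R by rewrite invr_ge0.
have := mean_leZ (expR_ge0 (2 * nu ^+ 2)^-1)
  (mean_leZ h (mean_leD (sqr_exp_moment b11) (sqr_exp_moment b21))).
rewrite /exp_moment_bound; set K0 := (2 * _ / _).
have -> : expR (2 * nu ^+ 2)^-1 * (2^-1 * (K0 + K0)) = expR (2 * nu ^+ 2)^-1 * K0.
  by field.
move=> /mean_le_dom; apply.
  apply: measurableT_comp => //; apply: measurable_funM => //.
  apply: measurableT_comp => //; apply: measurable_funB => //.
  by apply: measurable_funM; exact: measurable_dotv_rv.
move=> w; rewrite expR_ge0 /=; move: (dotv b1 (y w)) (dotv b2 (y w)) => U V.
set v := 2 * nu ^+ 2; have v0 : 0 < v by rewrite mulr_gt0 ?exprn_gt0.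
have b12 : `|dotv b1 b2| <= 1.
  by apply: le_trans (cauchy_schwarz _ _) _; rewrite b11 b21 mulr1.
have UV : `|U * V| <= (U ^+ 2 + V ^+ 2) / 2.
  rewrite normrM -(real_normK (num_real U)) -(real_normK (num_real V)).
  by have := sqr_ge0 (`|U| - `|V|); nra.
have : `|U * V - dotv b1 b2| <= 1 + (U ^+ 2 + V ^+ 2) / 2.
  by apply: le_trans (ler_normB _ _) _; rewrite addrC lerD.
move=> H.
apply: (@le_trans _ _ (expR (v^-1 + (U ^+ 2 / v + V ^+ 2 / v) / 2))).
  rewrite ler_expR; apply: le_trans (_ : (1 + (U ^+ 2 + V ^+ 2) / 2) / v <= _).
    by rewrite ler_pM2r ?invr_gt0.
  by rewrite le_eqVlt; apply/orP; left; apply/eqP; field; rewrite gt_eqF.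
rewrite expRD ler_wpM2l ?expR_ge0//.
have -> : (U ^+ 2 / v + V ^+ 2 / v) / 2 = U ^+ 2 / v / 2 + V ^+ 2 / v / 2 by field; rewrite gt_eqF.
have half x : expR x = expR (x / 2) ^+ 2 :> R.
  by rewrite expr2 -expRD; congr expR; field.
rewrite expRD (half (U ^+ 2 / v)) (half (V ^+ 2 / v)).
by have := sqr_ge0 (expR (U ^+ 2 / v / 2) - expR (V ^+ 2 / v / 2)); nra.
Qed.

Lemma exp_moment_integrable (W : T -> R) (C : R) : measurable_fun [set: T] W ->
  mean_le P (fun w => expR (`|W w| / (2 * nu ^+ 2))) C ->
  P.-integrable [set: T] (EFin \o W).
Proof.
move=> mW WC; have K0 : 0 < 2 * nu ^+ 2 by rewrite mulr_gt0 ?exprn_gt0.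
apply: mean_le_integrable_norm (mean_leZ (ltW K0) WC) mW _ => w.
rewrite mulrC -ler_pdivrMr//; apply: le_trans (expR_ge1Dx _).
by rewrite lerDr.
Qed.

Lemma norm2_delta (j : 'I_p) : norm2 (delta_mx j 0 : 'cV[R]_p) = 1.
Proof. by rewrite norm2_sqrt dotv_delta mxE !eqxx sqrtr1. Qed.

Lemma integrable_coord (j : 'I_p) :
  P.-integrable [set: T] (fun w => (y w j 0)%:E).
Proof.
have := exp_moment_integrable (measurable_dotv_rv _) (linear_exp_moment (norm2_delta j)).
by apply: eq_integrable => // w _; rewrite /= dotv_delta.
Qed.

Lemma integrable_coordM (j k : 'I_p) :
  P.-integrable [set: T] (fun w => (y w j 0 * y w k 0)%:E).
Proof.
have m : measurable_fun [set: T]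
    (fun w => dotv (delta_mx j 0) (y w) * dotv (delta_mx k 0) (y w) -
       dotv (delta_mx j 0) (delta_mx k 0)).
  apply: measurable_funB => //.
  by apply: measurable_funM; exact: measurable_dotv_rv.
have := exp_moment_integrable m (product_exp_moment (norm2_delta j) (norm2_delta k)).
move=> /(integrableD measurableT)/(_ (finite_measure_integrable_cst P
  (dotv (delta_mx j 0) (delta_mx k 0)) measurableT)).
apply: eq_integrable => // w _; rewrite /= -EFinD subrK !dotv_delta//.
Qed.

Lemma expectation_linear (b : 'cV[R]_p) : (\int[P]_w (dotv b (y w))%:E = 0)%E.
Proof.
under eq_integral do rewrite dotvE -sumEFin.
rewrite integral_sum//; last first.
  by move=> j; under eq_fun do rewrite EFinM; apply: integrableZl => //;
     exact: integrable_coord.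
rewrite big1// => j _; under eq_integral do rewrite EFinM.
rewrite integralZl//; last exact: integrable_coord.
by case: iso => /(_ j); rewrite unlock => -> _ _; rewrite mule0.
Qed.

Lemma expectation_product (b1 b2 : 'cV[R]_p) :
  (\int[P]_w (dotv b1 (y w) * dotv b2 (y w) - dotv b1 b2)%:E = 0)%E.
Proof.
have ijk (j k : 'I_p) : P.-integrable [set: T]
    (fun w => (b1 j 0 * b2 k 0 * (y w j 0 * y w k 0))%:E).
  under eq_fun do rewrite EFinM; apply: integrableZl => //.
  exact: integrable_coordM.
have E : (\int[P]_w (dotv b1 (y w) * dotv b2 (y w))%:E = (dotv b1 b2)%:E)%E.
  transitivity (\int[P]_w (\sum_j \sum_k (b1 j 0 * b2 k 0 * (y w j 0 * y w k 0))%:E)%R)%E.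
    apply: eq_integral => w _; rewrite !dotvE mulr_suml -sumEFin.
    apply: eq_bigr => j _; rewrite mulr_sumr -sumEFin; apply: eq_bigr => k _.
    by congr EFin; ring.
  rewrite integral_sum//; last first.
    by move=> j; exact: integrable_sum.
  rewrite dotvE -sumEFin; apply: eq_bigr => j _.
  rewrite integral_sum// (bigD1 j)//= big1 ?adde0.
    under eq_integral do rewrite EFinM.
    rewrite integralZl//; last exact: integrable_coordM.
    by case: iso => _ /(_ j j); rewrite unlock => -> _; rewrite eqxx mule1.
  move=> k kj; under eq_integral do rewrite EFinM.
  rewrite integralZl//; last exact: integrable_coordM.
  by case: iso => _ /(_ j k); rewrite unlock => -> _; rewrite eq_sym (negbTE kj) mule0.
have i : P.-integrable [set: T] (fun w => (dotv b1 (y w) * dotv b2 (y w))%:E).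
  have : P.-integrable [set: T]
      (fun w => (\sum_j \sum_k (b1 j 0 * b2 k 0 * (y w j 0 * y w k 0))%:E)%R).
    by apply: integrable_sum => // j _; exact: integrable_sum.
  apply: eq_integrable => // w _; rewrite !dotvE mulr_suml -sumEFin.
  apply: eq_bigr => j _; rewrite mulr_sumr -sumEFin; apply: eq_bigr => k _.
  by congr EFin; ring.
under eq_integral do rewrite EFinB.
rewrite integralB//; last exact: (finite_measure_integrable_cst P _ measurableT).
by rewrite E integral_cst//= probability_setT mule1 subee.
Qed.

(** [mgf_const] and [mgf_radius] are the constants 16 K^2 C and 1 / (2 K) of [mgf_le] at K = 2
    v^2. *)
Definition mgf_const (v : R) : R := 16 * (2 * v ^+ 2) ^+ 2 * exp_moment_bound v.

Definition mgf_radius (v : R) : R := (2 * (2 * v ^+ 2))^-1.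

Lemma linear_mgf (b : 'cV[R]_p) a : norm2 b = 1 -> `|a| <= mgf_radius nu ->
  mean_le P (fun w => expR (a * dotv b (y w))) (expR (mgf_const nu * a ^+ 2)).
Proof.
move=> b1 ha; apply: mgf_le ha; first by rewrite mulr_gt0 ?exprn_gt0.
- exact: measurable_dotv_rv.
- exact: linear_exp_moment.
- exact: expectation_linear.
Qed.

Lemma product_mgf (b1 b2 : 'cV[R]_p) a : norm2 b1 = 1 -> norm2 b2 = 1 ->
  `|a| <= mgf_radius nu ->
  mean_le P (fun w => expR (a * (dotv b1 (y w) * dotv b2 (y w) - dotv b1 b2)))
    (expR (mgf_const nu * a ^+ 2)).
Proof.
move=> b11 b21 ha; apply: mgf_le ha; first by rewrite mulr_gt0 ?exprn_gt0.
- apply: measurable_funB => //.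
  by apply: measurable_funM; exact: measurable_dotv_rv.
- exact: product_exp_moment.
- exact: expectation_product.
Qed.

End Moments.

(** * Sample mean and covariance *)

Section Deviations.
Context {R : realType} {n p : nat}.
Implicit Types (y : 'I_n -> 'cV[R]_p) (b u v : 'cV[R]_p).

Definition lin_dev y b : R := n%:R^-1 * \sum_i dotv b (y i).

Definition quad_dev y u v : R :=
  n%:R^-1 * \sum_i (dotv u (y i) * dotv v (y i) - dotv u v).

Lemma lin_devZ y b a : lin_dev y (a *: b) = a * lin_dev y b.
Proof.
rewrite /lin_dev mulrCA; congr (_ * _); rewrite mulr_sumr.
by apply: eq_bigr => i _; rewrite dotvZl.
Qed.

Lemma quad_devZ y u v (a c : R) :
  quad_dev y (a *: u) (c *: v) = a * c * quad_dev y u v.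
Proof.
rewrite /quad_dev mulrCA; congr (_ * _); rewrite mulr_sumr.
by apply: eq_bigr => i _; rewrite !dotvZl dotvZr; ring.
Qed.

(** Chernoff's bound before averaging: a summand reaches 1 exactly when its deviation reaches [x]
    (for [a > 0]). The factor [n] turns an empirical mean into a sum of independent terms. *)
Definition exceedance (I : finType) (dev : I -> R) (a x : R) : R :=
  \sum_i expR (a * (n%:R * (dev i - x))).

Lemma exceedance_ge0 (I : finType) (dev : I -> R) (a x : R) : 0 <= exceedance dev a x.
Proof. by apply: sumr_ge0 => i _; exact: expR_ge0. Qed.

Lemma exceedance_lt1 (I : finType) (dev : I -> R) (a x : R) : 0 < a -> (0 < n)%N ->
  exceedance dev a x < 1 -> forall i, dev i <= x.
Proof.
move=> a0 n0 dev1 i; have : expR (a * (n%:R * (dev i - x))) < 1.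
  apply: le_lt_trans dev1; rewrite /exceedance (bigD1 i)//= lerDl.
  by apply: sumr_ge0 => k _; exact: expR_ge0.
rewrite expR_lt1 pmulr_rlt0// pmulr_rlt0 ?ltr0n// subr_lt0.
exact: ltW.
Qed.

End Deviations.

Section NoiseMgf.
Context {R : realType} {n p : nat} d (T : measurableType d) (P : probability T R).
Variables (nu : R) (nu0 : 0 < nu) (n0 : (0 < n)%N) (Y : 'I_n -> T -> 'cV[R]_p).
Hypothesis noise : iid_noise P nu Y.

Lemma noise_mgf (g : 'cV[R]_p -> R) (m a : R) :
  measurable_fun [set: g_sigma_algebraType (@borel_generators R p)] g ->
  (forall i, mean_le P (fun w => expR (a * g (Y i w))) (expR m)) ->
  mean_le P (fun w => expR (a * \sum_i g (Y i w))) (expR (n%:R * m)).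
Proof.
move=> mg gm.
have -> : expR (n%:R * m) = \prod_(i < n) expR m.
  by rewrite prodr_const card_ord expRM_natl.
under eq_fun do rewrite mulr_sumr expR_sum.
apply: mean_le_prod => // A mA; case: noise => rY indY _ _.
have mga : measurable_fun [set: g_sigma_algebraType (@borel_generators R p)]
    (fun v : 'cV[R]_p => expR (a * g v)).
  by apply: measurableT_comp => //; exact: measurable_funM.
(* Independence is stated for Borel sets of vectors, so an event on exp (a g (Y_i)) is pulled back
   to R^p. *)
pose B i := (fun v : 'cV[R]_p => expR (a * g v)) @^-1` A i.
have mB i : borel_vec (B i).
  by have := mga measurableT (A i) (mA i); rewrite setTI.
have mYB i : measurable (Y i @^-1` B i).
  have := random_vector_measurable (rY i) measurableT (mB i).
  by rewrite setTI.
have PB i : P (Y i @^-1` B i) = (fine (P (Y i @^-1` B i)))%:E.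
  by rewrite fineK// fin_num_measure.
have mAll : measurable [set w | forall i, B i (Y i w)].
  rewrite (_ : [set w | _] = \bigcap_(i in [set: 'I_n]) (Y i @^-1` B i)).
    by apply: fin_bigcap_measurable => //= i _; exact: mYB.
  by apply/seteqP; split => w /= h i; [move=> _|]; exact: h.
have E := congr1 EFin (indY B mB); rewrite fineK ?fin_num_measure// in E.
rewrite -prodEFin in E; rewrite [LHS]E; by apply: eq_bigr => i _; rewrite -PB.
Qed.

Lemma lin_dev_mgf (b : 'cV[R]_p) a : norm2 b = 1 -> `|a| <= mgf_radius nu ->
  mean_le P (fun w => expR (a * (n%:R * lin_dev (Y^~ w) b)))
    (expR (n%:R * (mgf_const nu * a ^+ 2))).
Proof.
move=> b1 ha; rewrite /lin_dev.
under eq_fun do rewrite mulVKf ?pnatr_eq0 -?lt0n//.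
apply: noise_mgf; first exact: measurable_dotv.
by move=> i; case: noise => rY _ _ iso; exact: linear_mgf.
Qed.

Lemma quad_dev_mgf (u v : 'cV[R]_p) a : norm2 u = 1 -> norm2 v = 1 ->
  `|a| <= mgf_radius nu ->
  mean_le P (fun w => expR (a * (n%:R * quad_dev (Y^~ w) u v)))
    (expR (n%:R * (mgf_const nu * a ^+ 2))).
Proof.
move=> u1 v1 ha; rewrite /quad_dev.
under eq_fun do rewrite mulVKf ?pnatr_eq0 -?lt0n//.
apply: (noise_mgf (g := fun y => dotv u y * dotv v y - dotv u v)).
  apply: measurable_funB => //.
  by apply: measurable_funM; exact: measurable_dotv.
by move=> i; case: noise => rY _ _ iso; exact: product_mgf.
Qed.

Lemma exceedance_mean (I : finType) (dev : I -> T -> R) (a u : R) :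
  (forall i, mean_le P (fun w => expR (a * (n%:R * dev i w)))
    (expR (n%:R * (mgf_const nu * a ^+ 2)))) ->
  mean_le P (fun w => exceedance (n := n) (dev^~ w) a u)
    (#|I|%:R * expR (n%:R * (mgf_const nu * a ^+ 2 - a * u))).
Proof.
move=> devm; rewrite /exceedance.
have -> : #|I|%:R * expR (n%:R * (mgf_const nu * a ^+ 2 - a * u)) =
    \sum_(i : I) (expR (- (n%:R * (a * u))) * expR (n%:R * (mgf_const nu * a ^+ 2))).
  rewrite sumr_const -[RHS]mulr_natl; congr (_ * _); rewrite -expRD.
  by congr expR; ring.
apply: mean_le_sum => i.
have /= := mean_leZ (expR_ge0 (- (n%:R * (a * u)))) (devm i).
by congr mean_le; apply/funext => w; rewrite -expRD; congr expR; ring.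
Qed.

Lemma signed_mgf (D : T -> R) (m a : R) :
  (forall a', `|a'| <= mgf_radius nu ->
     mean_le P (fun w => expR (a' * (n%:R * D w))) (expR (n%:R * (m * a' ^+ 2)))) ->
  `|a| <= mgf_radius nu -> forall s : bool,
  mean_le P (fun w => expR (a * (n%:R * ((-1) ^+ s * D w))))
    (expR (n%:R * (m * a ^+ 2))).
Proof.
move=> H ha s; have := H ((-1) ^+ s * a).
rewrite normrM normrX normrN1 expr1n mul1r => /(_ ha).
rewrite exprMn sqrr_sign mul1r; congr mean_le.
by apply/funext => w; congr expR; ring.
Qed.

End NoiseMgf.

Section Model.
Context {R : realType} {n p : nat}.
Variables (Sigma S : 'M[R]_p) (mu : 'cV[R]_p) (y : 'I_n -> 'cV[R]_p).
Hypotheses (n0 : (0 < n)%N) (sS : S^T = S) (SS : S *m S = Sigma).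
Let X i := S *m y i + mu.
Implicit Types u v : 'cV[R]_p.

Lemma dotv_root u v : dotv (S *m u) (S *m v) = dotv u (Sigma *m v).
Proof. by rewrite -SS -mulmxA (dotv_mulmx u) sS. Qed.

Lemma dotv_mean_hat v : dotv v (mean_hat X) = lin_dev y (S *m v) + dotv v mu.
Proof.
rewrite /mean_hat dotvZr dotv_sumr /lin_dev.
under eq_bigr do rewrite /X dotvDr dotv_mulmx sS.
rewrite big_split /= mulrDr sumr_const card_ord -[dotv v mu *+ n]mulr_natl mulKf//.
by rewrite pnatr_eq0 -lt0n.
Qed.

(** [mu] cancels, and centring at the sample mean instead of the true one costs only a product of
    two linear deviations. *)
Lemma dotv_cov_hat u v : dotv u (cov_hat X *m v) =
  dotv u (Sigma *m v) + quad_dev y (S *m u) (S *m v)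
  - lin_dev y (S *m u) * lin_dev y (S *m v).
Proof.
have nn : n%:R != 0 :> R by rewrite pnatr_eq0 -lt0n.
have XE w i : dotv w (X i - mean_hat X) = dotv (S *m w) (y i) - lin_dev y (S *m w).
  by rewrite dotvBr dotv_mean_hat /X dotvDr (dotv_mulmx w) sS; ring.
rewrite /cov_hat -scalemxAl dotvZr mulmx_suml dotv_sumr.
transitivity (n%:R^-1 * \sum_i (dotv (S *m u) (y i) - lin_dev y (S *m u)) *
    (dotv (S *m v) (y i) - lin_dev y (S *m v))).
  congr (_ * _); apply: eq_bigr => i _; rewrite -!XE.
  rewrite /dotv -!mulmxA (mulmxA u^T) [LHS]mxE big_ord1.
  by rewrite -[(v^T *m _) 0 0]/(dotv v _) (dotvC v).
rewrite -dotv_root /quad_dev sumrB sumr_const card_ord -[dotv (S *m u) (S *m v) *+ n]mulr_natl.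
rewrite [in RHS]mulrBr mulKf// (addrC (dotv _ _) (_ - _)) subrK.
have L w : \sum_i dotv (S *m w) (y i) = n%:R * lin_dev y (S *m w).
  by rewrite /lin_dev mulVKf.
under eq_bigr do rewrite mulrBl !mulrBr.
rewrite !sumrB -mulr_sumr -mulr_suml !L sumr_const card_ord -[_ * _ *+ n]mulr_natl.
by field.
Qed.

Lemma cov_hat_sym : (cov_hat X)^T = cov_hat X.
Proof.
rewrite /cov_hat linearZ /= raddf_sum /=; congr (_ *: _).
by apply: eq_bigr => i _; rewrite trmx_mul trmxK.
Qed.

Lemma cov_hat_psd v : 0 <= qform (cov_hat X) v.
Proof.
rewrite qformE /cov_hat -scalemxAl dotvZr mulmx_suml dotv_sumr.
rewrite mulr_ge0 ?invr_ge0// sumr_ge0// => i _.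
rewrite /dotv -mulmxA (mulmxA v^T) [leRHS]mxE big_ord1.
by rewrite -[leRHS]/(dotv v _ * dotv _ v) (dotvC _ v) -expr2 sqr_ge0.
Qed.

End Model.

(** * The exceptional event *)

Section Exceptional.
Context {R : realType} {n p : nat}.
Variables (S : 'M[R]_p) (alpha : 'cV[R]_p) (dir : 'cV[R]_p -> 'cV[R]_p).
Implicit Types (y : 'I_n -> 'cV[R]_p).

Local Notation basis j := (delta_mx j 0 : 'cV[R]_p).

(* At least [1] as soon as one of the deviations below exceeds its threshold; it
   stands in for the indicator of that event, and its mean for a union bound. *)
Definition exceptional (d : nat) (a1 r a2 : R) y : R :=
  exceedance (n := n) (fun k : 'I_p * bool => (-1) ^+ k.2 * lin_dev y (dir (S *m basis k.1))) a1 r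
  + exceedance (n := n) (fun k : 'I_p * bool => (-1) ^+ k.2 *
      quad_dev y (dir (S *m basis k.1)) (dir (S *m alpha))) a1 r
  + exceedance (n := n) (fun s : bool => (-1) ^+ s * lin_dev y (dir (S *m alpha))) a2 1
  + exceedance (n := n) (fun j : 'I_p => quad_dev y (dir (S *m basis j)) (dir (S *m basis j))) a2 1
  + exceedance (n := n) (fun f : d.+1.-tuple ('I_p * bool) =>
      - quad_dev y (dir (S *m signed_sum f)) (dir (S *m signed_sum f))) a2 4^-1
  + exceedance (n := n) (fun k : d.+1.-tuple ('I_p * bool) * bool =>
      (-1) ^+ k.2 * lin_dev y (dir (S *m signed_sum k.1))) a2 2^-1.

Lemma norm_le_of_signs (x r : R) : (forall s : bool, (-1) ^+ s * x <= r) -> `|x| <= r.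
Proof.
move=> H; rewrite ler_norml; have := H true; have := H false.
by rewrite expr0 expr1 mul1r mulN1r => -> xr; rewrite lerNl xr.
Qed.

Lemma exceptional_lt1 d a1 r a2 y : (0 < n)%N -> 0 < a1 -> 0 < a2 ->
  exceptional d a1 r a2 y < 1 ->
  [/\ forall j, `|lin_dev y (dir (S *m basis j))| <= r,
      forall j, `|quad_dev y (dir (S *m basis j)) (dir (S *m alpha))| <= r,
      `|lin_dev y (dir (S *m alpha))| <= 1 &
      forall j, quad_dev y (dir (S *m basis j)) (dir (S *m basis j)) <= 1] /\
  forall f : d.+1.-tuple ('I_p * bool),
      - 4^-1 <= quad_dev y (dir (S *m signed_sum f)) (dir (S *m signed_sum f)) /\
      `|lin_dev y (dir (S *m signed_sum f))| <= 2^-1.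
Proof.
move=> n0 a10 a20; rewrite /exceptional.
set E1 := exceedance _ _ _; set E2 := exceedance _ _ _.
set E3 := exceedance _ _ _; set E4 := exceedance _ _ _.
set E5 := exceedance _ _ _; set E6 := exceedance _ _ _.
have h1 : 0 <= E1 := exceedance_ge0 _ _ _.
have h2 : 0 <= E2 := exceedance_ge0 _ _ _.
have h3 : 0 <= E3 := exceedance_ge0 _ _ _.
have h4 : 0 <= E4 := exceedance_ge0 _ _ _.
have h5 : 0 <= E5 := exceedance_ge0 _ _ _.
have h6 : 0 <= E6 := exceedance_ge0 _ _ _.
move=> E; split; first split.
- move=> j; apply: norm_le_of_signs => s.
  have /(exceedance_lt1 a10 n0)/(_ (j, s)) : E1 < 1 by lra.
  by [].
- move=> j; apply: norm_le_of_signs => s.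
  have /(exceedance_lt1 a10 n0)/(_ (j, s)) : E2 < 1 by lra.
  by [].
- apply: norm_le_of_signs => s.
  have /(exceedance_lt1 a20 n0)/(_ s) : E3 < 1 by lra.
  by [].
- by apply: (exceedance_lt1 a20 n0); rewrite -/E4; lra.
move=> f; split.
  have /(exceedance_lt1 a20 n0)/(_ f) : E5 < 1 by lra.
  by rewrite lerNl.
apply: norm_le_of_signs => s.
have /(exceedance_lt1 a20 n0)/(_ (f, s)) : E6 < 1 by lra.
by [].
Qed.

End Exceptional.

Section ExceptionalMean.
Context {R : realType} {n p : nat} d (T : measurableType d) (P : probability T R).
Variables (nu : R) (nu0 : 0 < nu) (n0 : (0 < n)%N) (Y : 'I_n -> T -> 'cV[R]_p).
Hypothesis noise : iid_noise P nu Y.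
Variables (S : 'M[R]_p) (alpha : 'cV[R]_p) (dir : 'cV[R]_p -> 'cV[R]_p).
Hypothesis dir1 : forall v, norm2 (dir v) = 1.

(* Small enough for the quadratic term of the exponent [mgf_const v * a^2 - a * u]
   to be at most half of the linear one at all thresholds [u >= 1/4]. *)
Definition tail_exponent (v : R) : R := Num.min (mgf_radius v) (8 * mgf_const v)^-1.

Lemma mgf_const_gt0 : 0 < mgf_const nu.
Proof.
have e : 0 < 1 - expR (- 2^-1) :> R by rewrite subr_gt0 expR_lt1 oppr_lt0 invr_gt0.
have v0 : 0 < 2 * nu ^+ 2 by rewrite mulr_gt0 ?exprn_gt0.
rewrite /mgf_const /exp_moment_bound.
apply: mulr_gt0; first by apply: mulr_gt0 => //; exact: exprn_gt0.
apply: mulr_gt0; first exact: expR_gt0.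
by apply: divr_gt0 => //; apply: mulr_gt0 => //; exact: expR_gt0.
Qed.

Lemma mgf_radius_gt0 : 0 < mgf_radius nu.
Proof. by rewrite invr_gt0 mulr_gt0// mulr_gt0 ?exprn_gt0. Qed.

Lemma tail_exponent_gt0 : 0 < tail_exponent nu.
Proof. by rewrite lt_min mgf_radius_gt0 invr_gt0 mulr_gt0// mgf_const_gt0. Qed.

Lemma tail_exponent_le (u : R) : 4^-1 <= u ->
  mgf_const nu * tail_exponent nu ^+ 2 - tail_exponent nu * u <=
  - (tail_exponent nu / 8).
Proof.
move=> u4; have C0 := mgf_const_gt0; have a0 := tail_exponent_gt0.
have : tail_exponent nu <= (8 * mgf_const nu)^-1 by rewrite ge_min lexx orbT.
have C8 : 0 < 8 * mgf_const nu by apply: mulr_gt0.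
rewrite -[leRHS]mul1r ler_pdivlMr// expr2 => H.
have : mgf_const nu * (tail_exponent nu * tail_exponent nu) <= tail_exponent nu / 8.
  by rewrite mulrCA ler_pM2l//; lra.
have : tail_exponent nu * 4^-1 <= tail_exponent nu * u by rewrite ler_pM2l.
lra.
Qed.

(** Counting the families: 2p + 2p signed deviations at the threshold [r]; then 2, p, (2p)^(m+1) and
    2 (2p)^(m+1) at thresholds of at least 1/4, where [tail_exponent_le] applies. *)
Lemma exceptional_mean (m : nat) (a1 r : R) : `|a1| <= mgf_radius nu ->
  mean_le P (fun w => exceptional S alpha dir m a1 r (tail_exponent nu) (Y^~ w))
    (4 * p%:R * expR (n%:R * (mgf_const nu * a1 ^+ 2 - a1 * r)) +
     (2 + p%:R + 3 * (2 * p%:R) ^+ m.+1) * expR (- (n%:R * (tail_exponent nu / 8)))).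
Proof.
move=> a1r; set a2 := tail_exponent nu.
have a2r : `|a2| <= mgf_radius nu.
  by rewrite ger0_norm ?ge_min ?lexx// ltW// tail_exponent_gt0.
have L b a : norm2 b = 1 -> `|a| <= mgf_radius nu -> forall s : bool,
    mean_le P (fun w => expR (a * (n%:R * ((-1) ^+ s * lin_dev (Y^~ w) b))))
      (expR (n%:R * (mgf_const nu * a ^+ 2))).
  by move=> b1 ha s; apply: (signed_mgf (nu := nu)) => // a' ha'; exact: lin_dev_mgf.
have Q u v a : norm2 u = 1 -> norm2 v = 1 -> `|a| <= mgf_radius nu ->
    forall s : bool,
    mean_le P (fun w => expR (a * (n%:R * ((-1) ^+ s * quad_dev (Y^~ w) u v))))
      (expR (n%:R * (mgf_const nu * a ^+ 2))).
  by move=> u1 v1 ha s; apply: (signed_mgf (nu := nu)) => // a' ha'; exact: quad_dev_mgf.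
have E1 := exceedance_mean r (fun k : 'I_p * bool =>
  L _ _ (dir1 (S *m delta_mx k.1 0)) a1r k.2).
have E2 := exceedance_mean r (fun k : 'I_p * bool =>
  Q _ _ _ (dir1 (S *m delta_mx k.1 0)) (dir1 (S *m alpha)) a1r k.2).
have E3 := exceedance_mean 1 (fun s : bool => L _ _ (dir1 (S *m alpha)) a2r s).
have E4 := exceedance_mean 1 (fun j : 'I_p =>
  quad_dev_mgf nu0 n0 noise (dir1 (S *m delta_mx j 0)) (dir1 (S *m delta_mx j 0)) a2r).
have E5 := exceedance_mean 4^-1 (fun f : m.+1.-tuple ('I_p * bool) =>
  Q _ _ _ (dir1 (S *m signed_sum f)) (dir1 (S *m signed_sum f)) a2r true).
have E6 := exceedance_mean 2^-1 (fun k : m.+1.-tuple ('I_p * bool) * bool =>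
  L _ _ (dir1 (S *m signed_sum k.1)) a2r k.2).
have := mean_leD (mean_leD (mean_leD (mean_leD (mean_leD E1 E2) E3) E4) E5) E6.
rewrite !card_prod card_tuple card_prod card_bool card_ord.
under [X in mean_le P X]eq_fun do under [exceedance _ _ 4^-1]eq_bigr do rewrite mulN1r.
move=> /mean_leW; apply.
have tail (u : R) : 4^-1 <= u ->
    expR (n%:R * (mgf_const nu * a2 ^+ 2 - a2 * u)) <= expR (- (n%:R * (a2 / 8))).
  by move=> u4; rewrite ler_expR -[leRHS]mulrN ler_wpM2l// tail_exponent_le.
have t1 := tail 1 ltac:(lra); have t4 := tail 4^-1 ltac:(lra).
have t2 := tail 2^-1 ltac:(lra).
rewrite !natrM natrX natrM; set X := expR (n%:R * (_ * a1 ^+ 2 - _)).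
set Z := expR (- _) in t1 t2 t4 *.
rewrite (mulrC p%:R 2); set K := (2 * p%:R) ^+ m.+1.
have K0 : 0 <= K by rewrite exprn_ge0// mulr_ge0.
have p0 : 0 <= p%:R :> R by [].
have := ler_wpM2l p0 t1; have := ler_wpM2l K0 t4; have := ler_wpM2l K0 t2.
lra.
Qed.

End ExceptionalMean.

Section PositiveDefinite.
Context {R : realType} {p : nat}.
Implicit Types (Sigma A : 'M[R]_p) (mu v : 'cV[R]_p).

Lemma symposdef_unit Sigma : symposdef Sigma -> Sigma \in unitmx.
Proof.
move=> [sS pS]; rewrite -row_free_unit -kermx_eq0; apply/eqP/row_matrixP => i.
rewrite row0; set v := row i _; have vS : v *m Sigma = 0.
  by rewrite /v -row_mul mulmx_ker row0.
apply/eqP; apply: contraT => v0.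
have /pS : v^T != 0 by rewrite trmx_eq0.
by rewrite /qform trmxK vS mul0mx mxE ltxx.
Qed.

Lemma alpha_ofK Sigma mu : symposdef Sigma -> Sigma *m alpha_of mu Sigma = mu.
Proof. by move=> /symposdef_unit uS; rewrite /alpha_of mulKVmx. Qed.

Lemma theta_ofE Sigma mu : symposdef Sigma ->
  theta_of mu Sigma = qform Sigma (alpha_of mu Sigma).
Proof.
move=> pS; rewrite /theta_of !qformE alpha_ofK//.
by rewrite -/(alpha_of mu Sigma) dotvC.
Qed.

Lemma diag_le_max_diag A j : A j j <= max_diag A.
Proof. by rewrite /max_diag; exact: (le_bigmax _ (fun j => A j j)). Qed.

End PositiveDefinite.

(** * Deterministic consequences of small deviations *)

Section Deterministic.
Context {R : realType} {n p : nat}.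
Variables (Sigma S : 'M[R]_p) (mu alpha : 'cV[R]_p) (y : 'I_n -> 'cV[R]_p).
Variables (dir : 'cV[R]_p -> 'cV[R]_p) (cU tau : R).
Hypotheses (n0 : (0 < n)%N) (sS : S^T = S) (SS : S *m S = Sigma).
Hypotheses (dirE : forall v, v = norm2 v *: dir v).
Hypotheses (Sa : Sigma *m alpha = mu) (diagU : forall j, Sigma j j <= cU).
Hypotheses (tauq : qform Sigma alpha <= tau) (cU0 : 0 < cU).
Let X i := S *m y i + mu.
Local Notation basis j := (delta_mx j 0 : 'cV[R]_p).

Lemma norm2_root v : norm2 (S *m v) ^+ 2 = qform Sigma v.
Proof. by rewrite norm2_sqr (dotv_root sS SS) qformE. Qed.

Lemma norm2_root_basis j : norm2 (S *m basis j) <= Num.sqrt cU.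
Proof.
rewrite -ler_sqr ?nnegrE ?norm2_ge0 ?sqrtr_ge0// norm2_root qform_delta.
by rewrite sqr_sqrtr// ltW.
Qed.

Lemma norm2_root_alpha : norm2 (S *m alpha) <= Num.sqrt tau.
Proof.
have t0 : 0 <= tau by apply: le_trans tauq; rewrite -norm2_root sqr_ge0.
rewrite -ler_sqr ?nnegrE ?norm2_ge0 ?sqrtr_ge0// norm2_root.
by rewrite sqr_sqrtr.
Qed.

Lemma lin_dev_dir v : lin_dev y (S *m v) =
  norm2 (S *m v) * lin_dev y (dir (S *m v)).
Proof. by rewrite {1}(dirE (S *m v)) lin_devZ. Qed.

Lemma quad_dev_dir u v : quad_dev y (S *m u) (S *m v) =
  norm2 (S *m u) * norm2 (S *m v) * quad_dev y (dir (S *m u)) (dir (S *m v)).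
Proof. by rewrite {1}(dirE (S *m u)) {1}(dirE (S *m v)) quad_devZ. Qed.

(** As [Sigma *m alpha = mu], the population terms cancel and an entry is Q - L La - L. It suffices
    that the deviation La along [alpha] be bounded by a constant times its scale, since L is already
    small; each of the three terms gets one third of the bound. *)
Lemma noise_bound (r : R) : 0 <= tau -> 0 <= r ->
  (forall j, `|lin_dev y (dir (S *m basis j))| <= r) ->
  (forall j, `|quad_dev y (dir (S *m basis j)) (dir (S *m alpha))| <= r) ->
  `|lin_dev y (dir (S *m alpha))| <= 1 ->
  forall j, `|(cov_hat X *m alpha - mean_hat X) j 0| <=
    3 * (Num.sqrt cU * Num.sqrt (1 + tau) * r).
Proof.
move=> t0 r0 H1 H3 H2 j.
rewrite -(dotv_delta j) dotvBr /X (dotv_cov_hat _ _ n0 sS SS) (dotv_mean_hat _ _ n0 sS).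
rewrite Sa.
set Q := quad_dev _ _ _; set L := lin_dev y (S *m basis j).
set La := lin_dev y (S *m alpha).
have -> : dotv (basis j) mu + Q - L * La - (L + dotv (basis j) mu) = Q - L * La - L.
  by ring.
have sj := norm2_root_basis j; have sa := norm2_root_alpha.
have sj0 := norm2_ge0 (S *m basis j); have sa0 := norm2_ge0 (S *m alpha).
have s1 : 1 <= Num.sqrt (1 + tau) by rewrite -{1}sqrtr1 ler_wsqrtr// lerDl.
have s2 : norm2 (S *m alpha) <= Num.sqrt (1 + tau).
  by apply: le_trans sa _; rewrite ler_wsqrtr// lerDr.
have bQ : `|Q| <= Num.sqrt cU * Num.sqrt (1 + tau) * r.
  rewrite /Q quad_dev_dir normrM normrM (ger0_norm sj0) (ger0_norm sa0).
  by apply: ler_pM => //; [exact: mulr_ge0|exact: ler_pM].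
have bL : `|L| <= Num.sqrt cU * r.
  by rewrite /L lin_dev_dir normrM (ger0_norm sj0) ler_pM.
have bLa : `|La| <= Num.sqrt (1 + tau).
  rewrite /La lin_dev_dir normrM (ger0_norm sa0) -[leRHS]mulr1.
  by apply: ler_pM.
have bLL : `|L * La| <= Num.sqrt cU * r * Num.sqrt (1 + tau).
  by rewrite normrM ler_pM.
have bL' : Num.sqrt cU * r <= Num.sqrt cU * r * Num.sqrt (1 + tau).
  by rewrite ler_peMr// mulr_ge0 ?sqrtr_ge0.
have := ler_normB (Q - L * La) L; have := ler_normB Q (L * La).
lra.
Qed.

(** The transfer principle for [cov_hat X - 2^-1 *: Sigma]. On signed sums 1 - 1/4 - (1/2)^2 = 1/2
    makes this form nonnegative, and its diagonal is at most (2 - 1/2) cU, hence at most 2 cU. *)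
Lemma restricted_convexity (d : nat) : (0 < d)%N ->
  (forall v, 0 <= qform Sigma v) ->
  (forall j, quad_dev y (dir (S *m basis j)) (dir (S *m basis j)) <= 1) ->
  (forall f : d.+1.-tuple ('I_p * bool),
      - 4^-1 <= quad_dev y (dir (S *m signed_sum f)) (dir (S *m signed_sum f)) /\
      `|lin_dev y (dir (S *m signed_sum f))| <= 2^-1) ->
  forall v, 2^-1 * qform Sigma v - 2 * cU / d%:R * norm1 v ^+ 2 <=
    qform (cov_hat X) v.
Proof.
move=> d0 q0 H4 H5 v.
have qB c B A u : qform (A - c *: B) u = qform A u - c * qform B u.
  by rewrite !qformE mulmxBl dotvBr -scalemxAl dotvZr.
have covE u : qform (cov_hat X) u = norm2 (S *m u) ^+ 2 *
    (1 + quad_dev y (dir (S *m u)) (dir (S *m u)) - lin_dev y (dir (S *m u)) ^+ 2).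
  rewrite qformE /X (dotv_cov_hat _ _ n0 sS SS) -qformE -norm2_root.
  rewrite lin_dev_dir quad_dev_dir; ring.
have cU2 : 0 <= 2 * cU by rewrite mulr_ge0// ltW.
have := @transfer_principle _ _ (cov_hat X - 2^-1 *: Sigma) d (2 * cU) d0 cU2.
move=> H; rewrite lerBlDr addrC -lerBlDr -opprB lerNl.
have := H _ _ v; rewrite qB lerNl opprB; apply.
- move=> j; rewrite -qform_delta qB covE norm2_root qform_delta.
  have := H4 j; have := diagU j; have := sqr_ge0 (lin_dev y (dir (S *m basis j))).
  have : 0 <= Sigma j j by rewrite -qform_delta.
  by nra.
- move=> f; rewrite qB covE norm2_root; have [h1 h2] := H5 f.
  have L2 : lin_dev y (dir (S *m signed_sum f)) ^+ 2 <= 4^-1.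
    rewrite -real_normK ?num_real//.
    have := normr_ge0 (lin_dev y (dir (S *m signed_sum f))); nra.
  rewrite (mulrC 2^-1) -mulrBr mulr_ge0//; lra.
Qed.

(** The exact second-order expansion of the quadratic functional [theta_tilde X] at [alpha]. Its
    error at [alpha] involves fluctuations in the single direction [S *m alpha], of order n^(-1/2);
    the rest is the quantity bounded in [lasso_error_bound]. *)
Lemma theta_decomposition a : theta_tilde X a - qform Sigma alpha =
  (2 * lin_dev y (S *m alpha) - quad_dev y (S *m alpha) (S *m alpha)
     + lin_dev y (S *m alpha) ^+ 2)
  + (2 * dotv (mean_hat X - cov_hat X *m alpha) (a - alpha)
     - qform (cov_hat X) (a - alpha)).
Proof.
have aE : a = alpha + (a - alpha) by rewrite addrCA subrr addr0.
move: (a - alpha) aE => delta ->.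
rewrite /theta_tilde qformD dotvDr dotvDl dotvNl.
rewrite (dotvC _ alpha) (dotv_mean_hat _ _ n0 sS).
rewrite [qform (cov_hat X) alpha]qformE (dotv_cov_hat _ _ n0 sS SS) -qformE.
rewrite (dotv_mulmx alpha (cov_hat _) delta) (cov_hat_sym).
rewrite (dotvC delta (cov_hat _ *m _)).
have -> : dotv alpha mu = qform Sigma alpha by rewrite qformE Sa.
ring.
Qed.

Lemma theta_oracle_le : 0 <= tau ->
  `|2 * lin_dev y (S *m alpha) - quad_dev y (S *m alpha) (S *m alpha)
     + lin_dev y (S *m alpha) ^+ 2| <=
  2 * Num.sqrt tau * `|lin_dev y (dir (S *m alpha))|
  + tau * `|quad_dev y (dir (S *m alpha)) (dir (S *m alpha))|
  + tau * lin_dev y (dir (S *m alpha)) ^+ 2.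
Proof.
move=> t0; rewrite quad_dev_dir lin_dev_dir exprMn -expr2 norm2_root.
set L := lin_dev _ _; set Q := quad_dev _ _ _.
have q0 : 0 <= qform Sigma alpha by rewrite -norm2_root sqr_ge0.
rewrite (le_trans (ler_normD _ _))// lerD//; last first.
  by rewrite normrM !ger0_norm ?sqr_ge0// ler_wpM2r ?sqr_ge0.
rewrite (le_trans (ler_normB _ _))// lerD//.
  rewrite mulrA !normrM ler_wpM2r// (ger0_norm (norm2_ge0 _)) ger0_norm//.
  by rewrite ler_wpM2l// norm2_root_alpha.
by rewrite normrM ger0_norm// ler_wpM2r.
Qed.

(** Entrywise Cauchy-Schwarz for mu_j = <S e_j, S alpha>. With only the diagonal of [Sigma] bounded,
    summing over entries brings in the factor [p], whose square root appears in the second risk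
    bound. *)
Lemma mean_norm_le : norm2 mu ^+ 2 <= p%:R * (cU * tau).
Proof.
have -> : p%:R * (cU * tau) = \sum_(j < p) (cU * tau).
  by rewrite sumr_const card_ord mulr_natl.
rewrite norm2_sqr dotvE; apply: ler_sum => j _.
rewrite -expr2 -real_normK ?num_real//.
rewrite -Sa -(dotv_delta j) -(dotv_root sS SS).
have t0 : 0 <= tau by apply: le_trans tauq; rewrite -norm2_root sqr_ge0.
have := cauchy_schwarz (S *m basis j) (S *m alpha).
have := norm2_root_basis j; have := norm2_root_alpha.
have := norm2_ge0 (S *m basis j); have := norm2_ge0 (S *m alpha).
have -> : cU * tau = (Num.sqrt cU * Num.sqrt tau) ^+ 2.
  by rewrite exprMn !sqr_sqrtr// ltW.
move=> a0 b0 ha hb cs.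
rewrite ler_sqr ?nnegrE ?mulr_ge0 ?sqrtr_ge0//; apply: le_trans cs _.
by apply: ler_pM.
Qed.

Lemma mean_hat_error_le :
  norm2 (mean_hat X - mu) ^+ 2 <= cU * \sum_j lin_dev y (dir (S *m basis j)) ^+ 2.
Proof.
rewrite norm2_sqr dotvE mulr_sumr; apply: ler_sum => j _.
rewrite -expr2 -(dotv_delta j) dotvBr (dotv_mean_hat _ _ n0 sS) addrK lin_dev_dir.
rewrite exprMn norm2_root qform_delta ler_wpM2r ?sqr_ge0//.
Qed.

End Deterministic.

(** * Bounds on the risk *)

(** The integral of a nonnegative function is a supremum over the simple functions below it, so
    monotonicity holds for arbitrary functions; it passes from a loss to its measurable majorant. *)
Lemma ge0_integral_mono (R : realType) d (T : measurableType d)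
    (P : {measure set T -> \bar R}) (f g : T -> \bar R) :
  (forall x, 0 <= f x)%E -> (forall x, f x <= g x)%E ->
  (\int[P]_x f x <= \int[P]_x g x)%E.
Proof.
move=> f0 fg; rewrite !ge0_integralTE//; last first.
  by move=> x; exact: le_trans (fg x).
apply: le_ereal_sup => _ [h hf <-]; exists h => // x.
exact: le_trans (fg x).
Qed.

Section Pointwise.
Context {R : realType} {n p : nat}.
Variables (Sigma S : 'M[R]_p) (mu alpha : 'cV[R]_p) (y : 'I_n -> 'cV[R]_p).
Variables (dir : 'cV[R]_p -> 'cV[R]_p) (cU cL tau : R).
Hypotheses (n0 : (0 < n)%N) (sS : S^T = S) (SS : S *m S = Sigma).
Hypotheses (dirE : forall v, v = norm2 v *: dir v).
Hypotheses (Sa : Sigma *m alpha = mu) (diagU : forall j, Sigma j j <= cU).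
Hypotheses (tauq : qform Sigma alpha <= tau) (cU0 : 0 < cU) (cL0 : 0 < cL).
Hypotheses (tau0 : 0 < tau) (Slow : forall v, cL * dotv v v <= qform Sigma v).
Let X i := S *m y i + mu.
Local Notation gamma := (2 * Num.sqrt (tau / cL)).
Local Notation basis j := (delta_mx j 0 : 'cV[R]_p).

Lemma norm2_alpha_le : norm2 alpha <= Num.sqrt (tau / cL).
Proof.
have tc0 : 0 <= tau / cL by rewrite divr_ge0// ltW.
rewrite -ler_sqr ?nnegrE ?norm2_ge0 ?sqrtr_ge0// (sqr_sqrtr tc0).
by rewrite norm2_sqr ler_pdivlMr// mulrC (le_trans (Slow alpha)).
Qed.

(** When [bad >= 1], |a - alpha| is at most gamma + sqrt (tau / cL) = 3 sqrt (tau / cL); its square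
    is 9 tau / cL, which may be multiplied by [bad]. *)
Lemma alpha_loss_pointwise (a : 'cV[R]_p) (A bad : R) : 0 <= A -> 0 <= bad ->
  norm2 a <= gamma ->
  (bad < 1 -> norm2 (a - alpha) ^+ 2 <= A) ->
  norm2 (a - alpha) ^+ 2 <= A + 9 * tau / cL * bad.
Proof.
move=> A0 b0 ag good; have K0 : 0 <= 9 * tau / cL.
  by rewrite divr_ge0 ?mulr_ge0// ltW.
have [/good b1|b1] := ltP bad 1.
  by rewrite (le_trans b1)// lerDl mulr_ge0.
have -> : 9 * tau / cL * bad = 9 * tau / cL + 9 * tau / cL * (bad - 1) by ring.
have : norm2 (a - alpha) <= 3 * Num.sqrt (tau / cL).
  apply: le_trans (norm2_triangle _ _) _; rewrite norm2N.
  by have := norm2_alpha_le; lra.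
have tc0 : 0 <= tau / cL by rewrite divr_ge0// ltW.
rewrite -ler_sqr ?nnegrE ?mulr_ge0 ?sqrtr_ge0 ?norm2_ge0// exprMn (sqr_sqrtr tc0).
have : 0 <= 9 * tau / cL * (bad - 1) by rewrite mulr_ge0// subr_ge0.
have -> : 3 ^+ 2 * (tau / cL) = 9 * tau / cL by ring.
lra.
Qed.

(** Feasibility of 0 makes the objective nonpositive at [a], that is,
    [theta_tilde X a >= 2 * lambda * norm1 a]. The upper bound drops the form and uses |a| <=
    gamma. *)
Lemma theta_tilde_range (a : 'cV[R]_p) (lambda : R) : 0 <= lambda ->
  lasso_solution X lambda gamma a ->
  0 <= theta_tilde X a <= 2 * (gamma * norm2 (mean_hat X)).
Proof.
move=> l0 [ag]; have g0 : 0 <= gamma by rewrite mulr_ge0 ?sqrtr_ge0.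
have z0 : norm2 (0 : 'cV[R]_p) = 0 by apply/eqP; rewrite norm2_eq0.
move=> /(_ 0); rewrite z0 => /(_ g0).
rewrite /lasso_objective /theta_tilde !qformE mulmx0 -[0 as X in dotv X]/(0).
have d0 (v : 'cV[R]_p) : dotv 0 v = 0 by rewrite -(scale0r 0) dotvZl mul0r.
have n10 : norm1 (0 : 'cV[R]_p) = 0 by apply/eqP; rewrite norm1_eq0.
rewrite !d0 n10 !mulr0 subr0 addr0 -qformE (dotvC a) => H.
have := mulr_ge0 l0 (norm1_ge0 a); have := @cov_hat_psd R n p S mu y a.
rewrite -/X => q0 l1.
have : dotv (mean_hat X) a <= gamma * norm2 (mean_hat X).
  apply: le_trans (ler_norm _) _; apply: le_trans (cauchy_schwarz _ _) _.
  by rewrite mulrC ler_wpM2r// norm2_ge0.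
lra.
Qed.

(** On the exceptional event the loss is at most tau + 2 gamma |hat mu|, and |hat mu - mu| <= (r +
    |hat mu - mu|^2 / r) / 2. The weight [r] stays free: the first half is charged to [bad], the
    second to a variance that is averaged over the whole space. *)
Lemma theta_loss_pointwise (a : 'cV[R]_p) (lambda A bad r : R) :
  0 <= lambda -> 0 <= A -> 0 <= bad -> 0 < r ->
  lasso_solution X lambda gamma a ->
  (bad < 1 -> 2 * `|dotv (mean_hat X - cov_hat X *m alpha) (a - alpha)|
     + qform (cov_hat X) (a - alpha) <= A) ->
  `|theta_tilde X a - qform Sigma alpha| <=
    2 * Num.sqrt tau * `|lin_dev y (dir (S *m alpha))|
    + tau * `|quad_dev y (dir (S *m alpha)) (dir (S *m alpha))|
    + tau * lin_dev y (dir (S *m alpha)) ^+ 2 + A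
    + (tau + 2 * gamma * Num.sqrt (p%:R * (cU * tau)) + gamma * r) * bad
    + gamma * cU / r * \sum_j lin_dev y (dir (S *m basis j)) ^+ 2.
Proof.
move=> l0 A0 b0 r0 sol good.
have t0 := ltW tau0.
have g0 : 0 <= gamma by rewrite mulr_ge0 ?sqrtr_ge0.
set B := _ + _ + tau * lin_dev _ _ ^+ 2.
have B0 : 0 <= B.
  have tQ : 0 <= tau * `|quad_dev y (dir (S *m alpha)) (dir (S *m alpha))|.
    by apply: mulr_ge0.
  have tL : 0 <= tau * lin_dev y (dir (S *m alpha)) ^+ 2.
    by apply: mulr_ge0 => //; exact: sqr_ge0.
  have sL : 0 <= Num.sqrt tau * `|lin_dev y (dir (S *m alpha))|.
    by apply: mulr_ge0 => //; exact: sqrtr_ge0.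
  rewrite /B; lra.
set V := \sum_j _; have V0 : 0 <= V by apply: sumr_ge0 => j _; exact: sqr_ge0.
have gV0 : 0 <= gamma * cU / r * V.
  by rewrite mulr_ge0// divr_ge0 ?(ltW r0)// mulr_ge0// ltW.
set N := Num.sqrt (p%:R * (cU * tau)); have N0 : 0 <= N := sqrtr_ge0 _.
have K0 : 0 <= tau + 2 * gamma * N + gamma * r.
  by rewrite !addr_ge0// !mulr_ge0 ?sqrtr_ge0// ltW.
have [/good b1|b1] := ltP bad 1.
  rewrite (theta_decomposition y n0 sS SS Sa).
  have := theta_oracle_le y sS SS dirE tauq t0; rewrite -/B => oracle.
  apply: le_trans (ler_normD _ _) _.
  have : `|2 * dotv (mean_hat X - cov_hat X *m alpha) (a - alpha) -
      qform (cov_hat X) (a - alpha)| <= A.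
    apply: le_trans (ler_normB _ _) _; rewrite normrM (ger0_norm (_ : 0 <= 2))//.
    by rewrite (ger0_norm (cov_hat_psd _ _ _ _)).
  have := mulr_ge0 K0 b0; lra.
have /andP[th0 th1] := theta_tilde_range l0 sol.
have q0 : 0 <= qform Sigma alpha.
  by apply: le_trans (Slow alpha); rewrite mulr_ge0 ?dotvv_ge0// ltW.
have bound : `|theta_tilde X a - qform Sigma alpha| <=
    tau + 2 * (gamma * norm2 (mean_hat X)).
  move: th0 th1 q0 (tauq); move: (gamma * _) (theta_tilde X a) (qform _ _) => g u v.
  by move=> u0 ug v0 vt; rewrite ler_norml; apply/andP; split; lra.
have mN : norm2 mu <= N.
  have pc0 : 0 <= p%:R * (cU * tau) by rewrite mulr_ge0// mulr_ge0// ltW.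
  rewrite -ler_sqr ?nnegrE ?norm2_ge0// (sqr_sqrtr pc0).
  exact: (mean_norm_le sS SS Sa diagU tauq cU0).
have mV : norm2 (mean_hat X - mu) <= (r + cU * V / r) / 2.
  have := mean_hat_error_le mu y n0 sS SS dirE diagU; rewrite -/X -/V => H.
  set x := norm2 _ in H *; have := sqr_ge0 (r - x) => sq.
  rewrite ler_pdivlMr// -(ler_pM2r r0) mulrDl divfK ?gt_eqF//.
  by move: sq H; clearbody x; rewrite !expr2; nra.
have mh : norm2 (mean_hat X) <= N + (r + cU * V / r) / 2.
  have -> : mean_hat X = mu + (mean_hat X - mu) by rewrite addrCA subrr addr0.
  by rewrite (le_trans (norm2_triangle _ _))// lerD.
have := ler_wpM2l g0 mh.
have -> : gamma * cU / r * V = gamma * (cU * V / r) by field; rewrite gt_eqF.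
have Kb : tau + 2 * gamma * N + gamma * r <= (tau + 2 * gamma * N + gamma * r) * bad.
  by rewrite ler_peMr.
lra.
Qed.

End Pointwise.

Section Risk.
Context {R : realType} {n p : nat} d (T : measurableType d) (P : probability T R).
Variables (nu : R) (nu0 : 0 < nu) (n0 : (0 < n)%N) (Y : 'I_n -> T -> 'cV[R]_p).
Hypothesis noise : iid_noise P nu Y.

(** At a = [mgf_radius nu] / sqrt n the exponent n C a^2 of the moment generating function is
    constant in n, while a n D = [mgf_radius nu] sqrt n D; hence |D| has mean of order n^(-1/2) and
    D^2 of order 1 / n. *)
Definition sym_exp (D : R) : R :=
  expR (mgf_radius nu / Num.sqrt n%:R * (n%:R * D)) +
  expR (- (mgf_radius nu / Num.sqrt n%:R) * (n%:R * D)).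

Definition moment_const : R := 2 * expR (mgf_const nu * mgf_radius nu ^+ 2).

Lemma mgf_scaling_const (D : T -> R) :
  (forall a, `|a| <= mgf_radius nu ->
     mean_le P (fun w => expR (a * (n%:R * D w)))
       (expR (n%:R * (mgf_const nu * a ^+ 2)))) ->
  mean_le P (fun w => sym_exp (D w)) moment_const.
Proof.
move=> H; have h0 := mgf_radius_gt0 nu0.
have n1 : 1 <= Num.sqrt n%:R :> R by rewrite -{1}sqrtr1 ler_wsqrtr// ler1n.
have sn0 : 0 < Num.sqrt n%:R :> R := lt_le_trans ltr01 n1.
have ha : `|mgf_radius nu / Num.sqrt n%:R| <= mgf_radius nu.
  rewrite ger0_norm ?divr_ge0 ?(ltW h0) ?(ltW sn0)//.
  by rewrite ler_pdivrMr// ler_peMr// ltW.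
have := mean_leD (H _ ha) (H (- (mgf_radius nu / Num.sqrt n%:R)) _).
rewrite normrN => /(_ ha); rewrite sqrrN expr_div_n sqr_sqrtr//.
have -> : n%:R * (mgf_const nu * (mgf_radius nu ^+ 2 / n%:R)) =
    mgf_const nu * mgf_radius nu ^+ 2.
  by field; rewrite pnatr_eq0 -lt0n.
by rewrite /moment_const mulr_natl mulr2n.
Qed.

Lemma sym_exp_ge (x : R) : `|x| <= expR x + expR (- x).
Proof.
have e (z : R) : z <= expR z by apply: le_trans (expR_ge1Dx z); rewrite lerDr.
rewrite ler_norml; have := e x; have := e (- x).
have := expR_gt0 x; have := expR_gt0 (- x); lra.
Qed.

Lemma abs_le_sym_exp (D : R) :
  `|D| <= (mgf_radius nu * Num.sqrt n%:R)^-1 * sym_exp D.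
Proof.
have h0 := mgf_radius_gt0 nu0.
have sn0 : 0 < Num.sqrt n%:R :> R by rewrite sqrtr_gt0 ltr0n.
have := sym_exp_ge (mgf_radius nu / Num.sqrt n%:R * (n%:R * D)).
rewrite -mulNr -/(sym_exp D).
have -> : mgf_radius nu / Num.sqrt n%:R * (n%:R * D) =
    mgf_radius nu * Num.sqrt n%:R * D.
  have nE : n%:R = Num.sqrt n%:R ^+ 2 :> R by rewrite sqr_sqrtr.
  rewrite [X in _ * (X * D)]nE.
  by field; rewrite gt_eqF.
rewrite normrM ger0_norm; last by rewrite mulr_ge0 ?ltW.
by move=> H; rewrite mulrC ler_pdivlMr ?mulr_gt0// mulrC.
Qed.

Lemma sqr_le_sym_exp (D : R) :
  D ^+ 2 <= 4 / (mgf_radius nu ^+ 2 * n%:R) * sym_exp D.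
Proof.
have h0 := mgf_radius_gt0 nu0.
have nn : 0 < n%:R :> R by rewrite ltr0n.
have sn0 : 0 < Num.sqrt n%:R :> R by rewrite sqrtr_gt0 ltr0n.
have sq (x : R) : x ^+ 2 <= 4 * (expR x + expR (- x)).
  have e (z : R) : 0 <= z -> z ^+ 2 <= 4 * expR z.
    move=> z0; have -> : expR z = expR (z / 2) ^+ 2.
      by rewrite expr2 -expRD; congr expR; field.
    have : z / 2 <= expR (z / 2) by apply: le_trans (expR_ge1Dx _); rewrite lerDr.
    rewrite -ler_sqr ?nnegrE ?expR_ge0 ?divr_ge0//.
    have -> : (z / 2) ^+ 2 = z ^+ 2 / 4 by field.
    lra.
  have := expR_gt0 x; have := expR_gt0 (- x).
  have [x0|x0] := leP 0 x; first by have := e x x0; lra.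
  have := e (- x); rewrite oppr_ge0 (ltW x0) => /(_ isT); rewrite sqrrN; lra.
have := sq (mgf_radius nu / Num.sqrt n%:R * (n%:R * D)).
rewrite -mulNr -/(sym_exp D) => H.
have hn : 0 < mgf_radius nu ^+ 2 * n%:R by rewrite mulr_gt0// exprn_gt0.
rewrite mulrAC ler_pdivlMr//; apply: le_trans H.
rewrite exprMn expr_div_n sqr_sqrtr// le_eqVlt; apply/orP; left; apply/eqP.
by field; rewrite gt_eqF.
Qed.

Variables (Sigma S : 'M[R]_p) (mu alpha : 'cV[R]_p).
Variables (dir : 'cV[R]_p -> 'cV[R]_p) (cU cL tau : R).
Hypotheses (sS : S^T = S) (SS : S *m S = Sigma).
Hypotheses (dirE : forall v, v = norm2 v *: dir v) (dir1 : forall v, norm2 (dir v) = 1).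
Hypotheses (Sa : Sigma *m alpha = mu) (diagU : forall j, Sigma j j <= cU).
Hypotheses (tauq : qform Sigma alpha <= tau) (cU0 : 0 < cU) (cL0 : 0 < cL).
Hypotheses (tau0 : 0 < tau) (Slow : forall v, cL * dotv v v <= qform Sigma v).
Variables (alphat : T -> 'cV[R]_p) (lambda : R) (bad : T -> R) (Pbad : R).
Let X w i := S *m Y i w + mu.
Local Notation gamma := (2 * Num.sqrt (tau / cL)).
Hypotheses (l0 : 0 <= lambda) (badm : mean_le P bad Pbad).
Hypothesis sol : forall w, lasso_solution (X w) lambda gamma (alphat w).

Lemma alpha_risk_le (A : R) : 0 <= A ->
  (forall w, bad w < 1 -> norm2 (alphat w - alpha) ^+ 2 <= A) ->
  ('E_P[fun w => (norm2 (alphat w - alpha) ^+ 2)%R] <= (A + 9 * tau / cL * Pbad)%:E)%E.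
Proof.
move=> A0 good; have K0 : 0 <= 9 * tau / cL.
  by rewrite divr_ge0 ?mulr_ge0// ltW.
have [_ _ domE] := mean_leD (mean_le_cst P A0) (mean_leZ K0 badm).
rewrite unlock; apply: le_trans domE; apply: ge0_integral_mono => w.
  by rewrite lee_fin sqr_ge0.
rewrite lee_fin; apply: (alpha_loss_pointwise tauq cL0 tau0 Slow) => //.
- by case: badm => _ + _; exact.
- by case: (sol w).
- exact: good.
Qed.

Lemma theta_risk_le (A r : R) : 0 <= A -> 0 < r ->
  (forall w, bad w < 1 ->
    2 * `|dotv (mean_hat (X w) - cov_hat (X w) *m alpha) (alphat w - alpha)|
     + qform (cov_hat (X w)) (alphat w - alpha) <= A) ->
  ('E_P[fun w => (`|theta_tilde (X w) (alphat w) - qform Sigma alpha|)%R] <=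
   ((2 * Num.sqrt tau + tau) * ((mgf_radius nu * Num.sqrt n%:R)^-1 * moment_const)
    + tau * (4 / (mgf_radius nu ^+ 2 * n%:R) * moment_const) + A
    + (tau + 2 * gamma * Num.sqrt (p%:R * (cU * tau)) + gamma * r) * Pbad
    + gamma * cU / r * (p%:R * (4 / (mgf_radius nu ^+ 2 * n%:R) * moment_const)))%:E)%E.
Proof.
move=> A0 r0 good; have t0 := ltW tau0.
have h0 := mgf_radius_gt0 nu0.
have g0 : 0 <= gamma by rewrite mulr_ge0 ?sqrtr_ge0.
set u := (mgf_radius nu * Num.sqrt n%:R)^-1.
set v := 4 / (mgf_radius nu ^+ 2 * n%:R).
have u0 : 0 <= u by rewrite invr_ge0 mulr_ge0 ?sqrtr_ge0// ltW.
have v0 : 0 <= v by rewrite divr_ge0// mulr_ge0// sqr_ge0.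
have symL b : norm2 b = 1 ->
    mean_le P (fun w => sym_exp (lin_dev (Y^~ w) b)) moment_const.
  by move=> b1; apply: mgf_scaling_const => a; exact: lin_dev_mgf.
have symQ := mgf_scaling_const (fun a => quad_dev_mgf nu0 n0 noise
  (dir1 (S *m alpha)) (dir1 (S *m alpha)) (a := a)).
have st0 : 0 <= 2 * Num.sqrt tau by rewrite mulr_ge0 ?sqrtr_ge0.
have K0 : 0 <= tau + 2 * gamma * Num.sqrt (p%:R * (cU * tau)) + gamma * r.
  by rewrite !addr_ge0// !mulr_ge0 ?sqrtr_ge0// ltW.
have G0 : 0 <= gamma * cU / r.
  by rewrite divr_ge0 ?(ltW r0)// mulr_ge0// ltW.
have M1 := mean_leZ st0 (mean_leZ u0 (symL _ (dir1 (S *m alpha)))).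
have M2 := mean_leZ t0 (mean_leZ u0 symQ).
have M3 := mean_leZ t0 (mean_leZ v0 (symL _ (dir1 (S *m alpha)))).
have M4 := mean_le_sum (index_enum 'I_p)
  (fun j => mean_leZ v0 (symL _ (dir1 (S *m delta_mx j 0)))).
have [_ _ domE] := mean_leD (mean_leD (mean_leD (mean_leD (mean_leD M1 M2) M3)
  (mean_le_cst P A0)) (mean_leZ K0 badm)) (mean_leZ G0 M4).
rewrite sumr_const card_ord in domE.
rewrite (mulr_natl (v * _)) mulrDl unlock; apply: le_trans domE.
apply: ge0_integral_mono => w; first by rewrite lee_fin.
rewrite lee_fin.
have := theta_loss_pointwise n0 sS SS dirE Sa diagU tauq cU0 cL0 tau0 Slow
  l0 A0 _ r0 (sol w) (good w).
case: badm => _ /(_ w) b0 _ /(_ b0) /le_trans; apply.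
rewrite lerD//; last first.
  by rewrite ler_wpM2l//; apply: ler_sum => j _; exact: sqr_le_sym_exp.
rewrite lerD2r lerD2r lerD//; last first.
  by rewrite ler_wpM2l//; exact: sqr_le_sym_exp.
by apply: lerD; apply: ler_wpM2l => //; exact: abs_le_sym_exp.
Qed.

End Risk.

(** * Choice of the constants and size of the exceptional event *)

Section Tail.
Context {R : realType}.
Variables (nu cL cU : R) (nu0 : 0 < nu) (cL0 : 0 < cL) (cU0 : 0 < cU).

(** Chosen so that [d = sparsity_factor * s] meets the condition 64 M s <= cL d of
    [lasso_error_bound] at M = 2 cU. *)
Definition sparsity_factor : nat := (Num.truncn (128 * cU / cL)).+1.

(* With the threshold [noise_ratio * t * sqrt (ln p / n)], the three deviations
   that make up an entry of hat Sigma alpha - hat mu sum to at most lambda / 2. *)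
Definition noise_ratio : R := nu / (6 * Num.sqrt cU).

(** The second entry keeps the quadratic term of the Chernoff exponent below half of the linear one
    when [t >= 1]; the remaining half is [decay_rate], the constant c_2 of the theorem. *)
Definition noise_exponent : R :=
  Num.min (mgf_radius nu) (noise_ratio / (2 * mgf_const nu)).

Definition decay_rate : R := noise_exponent * noise_ratio / 2.

(** The bound 1/2 keeps tilde c below 1 and ln p / n below 1. The other entry, with K the sparsity
    factor and c' the tail rate, ensures (K s + 1) ln p <= n c' / 4. *)
Definition sample_threshold : R :=
  Num.min 2^-1 (tail_exponent nu / 8 / (4 * (sparsity_factor%:R + 1))).

Lemma noise_ratio_gt0 : 0 < noise_ratio.
Proof. by rewrite divr_gt0// mulr_gt0// sqrtr_gt0. Qed.

Lemma noise_exponent_gt0 : 0 < noise_exponent.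
Proof.
rewrite lt_min mgf_radius_gt0//= divr_gt0 ?noise_ratio_gt0//.
by apply: mulr_gt0 => //; exact: mgf_const_gt0.
Qed.

Lemma decay_rate_gt0 : 0 < decay_rate.
Proof. by rewrite divr_gt0// mulr_gt0 ?noise_exponent_gt0 ?noise_ratio_gt0. Qed.

Lemma sample_threshold_gt0 : 0 < sample_threshold.
Proof.
rewrite lt_min invr_gt0 ltr0n/= divr_gt0//.
by rewrite divr_gt0// tail_exponent_gt0.
Qed.

Lemma sparsity_factor_ge : 128 * cU <= cL * sparsity_factor%:R.
Proof.
by rewrite [leRHS]mulrC -ler_pdivrMr// ltW// truncnS_gt.
Qed.

Lemma noise_exponent_le (t : R) : 1 <= t ->
  mgf_const nu * noise_exponent ^+ 2 - noise_exponent * (noise_ratio * t) <=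
  - (decay_rate * t).
Proof.
move=> t1; have C0 := mgf_const_gt0 nu0; have e0 := noise_exponent_gt0.
have k0 := noise_ratio_gt0.
have : noise_exponent <= noise_ratio / (2 * mgf_const nu) by rewrite ge_min lexx orbT.
have C2 : 0 < 2 * mgf_const nu by apply: mulr_gt0.
rewrite ler_pdivlMr// => H.
have : mgf_const nu * noise_exponent ^+ 2 <= decay_rate.
  rewrite /decay_rate expr2 mulrCA -mulrA ler_pM2l//; lra.
have : decay_rate <= decay_rate * t by rewrite ler_peMr// ltW// decay_rate_gt0.
have -> : noise_exponent * (noise_ratio * t) = 2 * (decay_rate * t).
  by rewrite /decay_rate; field.
lra.
Qed.

(** In the first term n l^2 = ln p for l = sqrt (ln p / n), so each of the exponentials is at most
    p^(- decay_rate t), and the factor p gives the - 1 in the exponent. In the second, half of n c'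
    pays for the number of signed sums and half for p^(-c). Each term is at most 4 times the
    power. *)
Lemma tail_arithmetic (c t : R) (n p s : nat) : 0 < c -> 1 <= t ->
  (0 < n)%N -> (1 < p)%N -> (0 < s)%N ->
  s%:R * ln p%:R / n%:R < sample_threshold / (1 + c) ->
  4 * p%:R * expR (n%:R * (mgf_const nu * (noise_exponent * Num.sqrt (ln p%:R / n%:R)) ^+ 2
     - noise_exponent * Num.sqrt (ln p%:R / n%:R) *
       (noise_ratio * t * Num.sqrt (ln p%:R / n%:R))))
  + (2 + p%:R + 3 * (2 * p%:R) ^+ (sparsity_factor * s).+1) *
    expR (- (n%:R * (tail_exponent nu / 8)))
  <= 8 * p%:R `^ (- Num.min (decay_rate * t - 1) c).
Proof.
move=> c0 t1 n0 p1 s0; set K := sparsity_factor; set L := ln p%:R.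
set m := Num.min _ c; set c' := tail_exponent nu / 8 => sLn.
have n0' : 0 < n%:R :> R by rewrite ltr0n.
have p0' : 0 < p%:R :> R by rewrite ltr0n ltnW.
have L0 : 0 < L by rewrite ln_gt0// ltr1n.
have pE : p%:R = expR L :> R by rewrite lnK.
have powE x : p%:R `^ x = expR (x * L) by rewrite /powR gt_eqF.
have c'0 : 0 < c' by rewrite divr_gt0// tail_exponent_gt0.
have l2 : Num.sqrt (L / n%:R) ^+ 2 = L / n%:R.
  by rewrite sqr_sqrtr// divr_ge0// ltW.
have mL : m * L <= (decay_rate * t - 1) * L by rewrite ler_pM2r// ge_min lexx.
have mcL : m * L <= c * L by rewrite ler_pM2r// ge_min lexx orbT.
rewrite powE.
have H1 : p%:R * expR (n%:R * (mgf_const nu * (noise_exponent * Num.sqrt (L / n%:R)) ^+ 2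
     - noise_exponent * Num.sqrt (L / n%:R) *
       (noise_ratio * t * Num.sqrt (L / n%:R)))) <= expR (- m * L).
  have -> : n%:R * (mgf_const nu * (noise_exponent * Num.sqrt (L / n%:R)) ^+ 2
     - noise_exponent * Num.sqrt (L / n%:R) *
       (noise_ratio * t * Num.sqrt (L / n%:R))) =
     n%:R * Num.sqrt (L / n%:R) ^+ 2 * (mgf_const nu * noise_exponent ^+ 2 -
       noise_exponent * (noise_ratio * t)) by ring.
  rewrite l2 pE -expRD ler_expR [n%:R * _]mulrC divfK ?gt_eqF//.
  have := ler_wpM2l (ltW L0) (noise_exponent_le t1).
  lra.
have K0 : 0 <= K%:R :> R by [].
have cc : 0 < 1 + c by rewrite addr_gt0.
have K4 : 0 < 4 * (K%:R + 1) :> R by rewrite mulr_gt0// ltr_wpDl.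
have sLn' : s%:R * L * (1 + c) < n%:R * sample_threshold.
  by move: sLn; rewrite ltr_pdivrMr// mulrAC ltr_pdivlMr// (mulrC n%:R).
have thr : 4 * (K%:R + 1) * sample_threshold <= c'.
  by rewrite mulrC -ler_pdivlMr// ge_min lexx orbT.
have s1 : 1 <= s%:R :> R by rewrite ler1n.
have sL : L <= s%:R * L by rewrite ler_peMl// ltW.
have th0 := sample_threshold_gt0.
have sL0 : 0 <= s%:R * L by rewrite mulr_ge0// ltW.
(* The division of the threshold by 1 + c is used here: c ln p <= c s ln p < n *
   [sample_threshold]. *)
have e1 : c * L <= n%:R * c' / 2.
  have : n%:R * (4 * (K%:R + 1) * sample_threshold) <= n%:R * c' by rewrite ler_pM2l.
  have : 0 <= n%:R * (K%:R * sample_threshold).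
    by rewrite mulr_ge0// mulr_ge0// ltW.
  have : 0 <= n%:R * sample_threshold by rewrite mulr_ge0// ltW.
  have : c * L <= c * (s%:R * L) by rewrite ler_pM2l.
  lra.
have e2 : 2 * ((K * s).+1%:R * L) <= n%:R * c' / 2.
  have : n%:R * (4 * (K%:R + 1) * sample_threshold) <= n%:R * c' by rewrite ler_pM2l.
  have : (K%:R + 1) * (s%:R * L) <= (K%:R + 1) * (n%:R * sample_threshold).
    rewrite ler_wpM2l ?addr_ge0// ltW//; apply: le_lt_trans sLn'.
    by rewrite ler_peMr// lerDl ltW.
  rewrite -[(K * s).+1%:R]natr1 natrM; lra.
have p2 : 2 <= p%:R :> R by rewrite ler_nat.
have W1 : 2 * p%:R <= (2 * p%:R) ^+ (K * s).+1 :> R.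
  have q1 : 1 <= 2 * p%:R :> R by lra.
  by rewrite exprS ler_peMr ?mulr_ge0// exprn_ege1.
have W2 : (2 * p%:R) ^+ (K * s).+1 <= expR (2 * ((K * s).+1%:R * L)).
  rewrite mulrCA expRM_natl lerXn2r ?nnegrE ?mulr_ge0 ?expR_ge0//.
  have -> : expR (2 * L) = p%:R * p%:R by rewrite pE -expRD; congr expR; ring.
  by rewrite ler_pM2r.
have H2 : (2 * p%:R) ^+ (K * s).+1 * expR (- (n%:R * c')) <= expR (- m * L).
  apply: le_trans (ler_wpM2r (expR_ge0 _) W2) _.
  rewrite -expRD ler_expR; lra.
have : (2 + p%:R + 3 * (2 * p%:R) ^+ (K * s).+1) * expR (- (n%:R * c')) <=
    4 * (2 * p%:R) ^+ (K * s).+1 * expR (- (n%:R * c')).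
  by rewrite ler_wpM2r ?expR_ge0//; lra.
lra.
Qed.

End Tail.

Section GoodEvent.
Context {R : realType} {n p : nat}.
Variables (Sigma S : 'M[R]_p) (mu alpha : 'cV[R]_p) (y : 'I_n -> 'cV[R]_p).
Variables (dir : 'cV[R]_p -> 'cV[R]_p) (cU cL tau : R).
Hypotheses (n0 : (0 < n)%N) (sS : S^T = S) (SS : S *m S = Sigma).
Hypotheses (dirE : forall v, v = norm2 v *: dir v).
Hypotheses (Sa : Sigma *m alpha = mu) (diagU : forall j, Sigma j j <= cU).
Hypotheses (tauq : qform Sigma alpha <= tau) (cU0 : 0 < cU) (cL0 : 0 < cL).
Hypotheses (tau0 : 0 < tau) (Slow : forall v, cL * dotv v v <= qform Sigma v).
Let X i := S *m y i + mu.
Local Notation gamma := (2 * Num.sqrt (tau / cL)).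

Lemma lasso_error_of_exceptional (a : 'cV[R]_p) (s d : nat) (lambda a1 r a2 : R) :
  0 < lambda -> (norm0 alpha <= s)%N -> (0 < d)%N ->
  64 * (2 * cU) * s%:R <= cL * d%:R -> 0 <= r -> 0 < a1 -> 0 < a2 ->
  6 * (Num.sqrt cU * Num.sqrt (1 + tau) * r) <= lambda ->
  lasso_solution X lambda gamma a ->
  exceptional S alpha dir d a1 r a2 y < 1 ->
  norm2 (a - alpha) ^+ 2 <= 144 / cL ^+ 2 * (lambda ^+ 2 * s%:R) /\
  2 * `|dotv (mean_hat X - cov_hat X *m alpha) (a - alpha)|
     + qform (cov_hat X) (a - alpha) <= 84 / cL * (lambda ^+ 2 * s%:R).
Proof.
move=> l0 als d0 dbig r0 a10 a20 lr [ag opt].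
move=> /(exceptional_lt1 n0 a10 a20)[[H1 H3 H2 H4] H5].
have cU2 : 0 <= 2 * cU by rewrite mulr_ge0// ltW.
have q0 v : 0 <= qform Sigma v.
  by apply: le_trans (Slow v); rewrite mulr_ge0 ?dotvv_ge0// ltW.
apply: (lasso_error_bound (cov_hat_sym S mu y) l0 als cL0 Slow
  (restricted_convexity mu n0 sS SS dirE diagU cU0 d0 q0 H4 H5) d0 cU2 dbig).
- move=> j.
  have := noise_bound n0 sS SS dirE Sa diagU tauq cU0 (ltW tau0) r0 H1 H3 H2 j.
  by move=> /le_trans; apply; lra.
- apply: opt; apply: le_trans (norm2_alpha_le tauq cL0 tau0 Slow) _.
  by have := sqrtr_ge0 (tau / cL); lra.
- exact: cov_hat_psd.
Qed.

End GoodEvent.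

(** * Assembly of the risk bounds *)

Section Assembly.
Context {R : realType}.

Definition theta_const (nu cL cU : R) : R :=
  let x := moment_const nu / mgf_radius nu in
  let y := 4 * moment_const nu / mgf_radius nu ^+ 2 in
  2 * x + y + 84 / cL * nu ^+ 2 + 8 + 32 * (Num.sqrt cU / Num.sqrt cL)
  + 16 / Num.sqrt cL + 2 * (cU / Num.sqrt cL) * y.

(** Read sg, sL, sU as the square roots of tau, cL, cU, and w = n^(-1/2), P = sqrt p, Q = p^(-m/2).
    The mean of [bad] is 8 Q^2 and the free weight is r = P / Q, which balances r Q^2 against P^2 /
    r: both equal P Q. Each summand then receives its own part of the constant. *)
Lemma theta_rate_arithmetic (sg sL sU x y a rate P Q w : R) :
  0 <= sg -> 0 < sL -> 0 < sU -> 0 <= x -> 0 <= y -> 0 <= a -> 0 <= rate ->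
  1 <= P -> 0 < Q -> Q <= 1 -> 0 <= w -> w <= 1 ->
  (2 * sg + sg ^+ 2) * (x * w) + sg ^+ 2 * (y * w ^+ 2) + a * rate
  + (sg ^+ 2 + 2 * (2 * (sg / sL)) * (P * (sU * sg)) + 2 * (sg / sL) * (P / Q)) * (8 * Q ^+ 2)
  + 2 * (sg / sL) * sU ^+ 2 / (P / Q) * (P ^+ 2 * (y * w ^+ 2)) <=
  (2 * x + y + a + 8 + 32 * (sU / sL) + 16 / sL + 2 * (sU ^+ 2 / sL) * y) *
    (rate + (sg ^+ 2 + sg) * (w + P * Q)).
Proof.
move=> g0 L0 U0 x0 y0 a0 r0 P1 Q0 Q1 w0 w1.
have P0 : 0 < P := lt_le_trans ltr01 P1.
set G := sg ^+ 2 + sg; set X := G * (w + P * Q).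
have g20 : 0 <= sg ^+ 2 := sqr_ge0 _.
have G0 : 0 <= G by rewrite addr_ge0.
have z0 : 0 < P * Q by rewrite mulr_gt0.
have gG : sg <= G by rewrite lerDr.
have g2G : sg ^+ 2 <= G by rewrite lerDl.
have Gw : G * w <= X by rewrite ler_wpM2l// lerDl ltW.
have Gz : G * (P * Q) <= X by rewrite ler_wpM2l// lerDr.
have X0 : 0 <= X by rewrite mulr_ge0// addr_ge0// ltW.
have w2 : w ^+ 2 <= w by rewrite expr2 ler_piMr.
have w20 : 0 <= w ^+ 2 := sqr_ge0 _.
have Qz : Q ^+ 2 <= P * Q by rewrite expr2 ler_pM2r// (le_trans Q1).
have iL : 0 < sL^-1 by rewrite invr_gt0.
have uL : 0 <= sU / sL by rewrite divr_ge0// ltW.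
have uuL : 0 <= sU ^+ 2 / sL by rewrite divr_ge0 ?sqr_ge0// ltW.
have T1 : (2 * sg + sg ^+ 2) * (x * w) <= 2 * x * X.
  have : x * ((2 * sg + sg ^+ 2) * w) <= x * (2 * G * w).
    by rewrite ler_wpM2l// ler_wpM2r// /G; lra.
  have : x * (G * w) <= x * X by rewrite ler_wpM2l.
  lra.
have T2 : sg ^+ 2 * (y * w ^+ 2) <= y * X.
  rewrite mulrCA ler_wpM2l//; apply: le_trans Gw; exact: ler_pM.
have T4a : sg ^+ 2 * (8 * Q ^+ 2) <= 8 * X.
  rewrite mulrCA ler_wpM2l//; apply: le_trans Gz; apply: ler_pM => //.
  exact: sqr_ge0.
have T4b : 2 * (2 * (sg / sL)) * (P * (sU * sg)) * (8 * Q ^+ 2) <=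
    32 * (sU / sL) * X.
  have -> : 2 * (2 * (sg / sL)) * (P * (sU * sg)) * (8 * Q ^+ 2) =
      32 * (sU / sL) * (sg ^+ 2 * (P * Q ^+ 2)) by field; rewrite gt_eqF.
  apply: ler_wpM2l; first by apply: mulr_ge0.
  apply: le_trans Gz; apply: ler_pM => //.
    by rewrite mulr_ge0 ?sqr_ge0// ltW.
  by rewrite ler_pM2l// expr2 ler_piMr// ltW.
have T4c : 2 * (sg / sL) * (P / Q) * (8 * Q ^+ 2) <= 16 / sL * X.
  have -> : 2 * (sg / sL) * (P / Q) * (8 * Q ^+ 2) = 16 / sL * (sg * (P * Q)).
    by field; rewrite !gt_eqF.
  apply: ler_wpM2l; first by apply: mulr_ge0 => //; exact: ltW.
  apply: le_trans Gz.
  by rewrite ler_pM2r.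
have T5 : 2 * (sg / sL) * sU ^+ 2 / (P / Q) * (P ^+ 2 * (y * w ^+ 2)) <=
    2 * (sU ^+ 2 / sL) * y * X.
  have -> : 2 * (sg / sL) * sU ^+ 2 / (P / Q) * (P ^+ 2 * (y * w ^+ 2)) =
      2 * (sU ^+ 2 / sL) * y * (sg * (P * Q) * w ^+ 2).
    by field; rewrite !gt_eqF.
  apply: ler_wpM2l; first by apply: mulr_ge0 => //; apply: mulr_ge0.
  apply: le_trans Gz; rewrite -[leRHS]mulr1; apply: ler_pM => //; last by rewrite (le_trans w2).
    by rewrite mulr_ge0// ltW.
  by rewrite ler_pM2r.
set C := _ + _ + a + _ + _ + _ + _.
have C0 : 2 * x + y + 8 + 32 * (sU / sL) + 16 / sL + 2 * (sU ^+ 2 / sL) * y = C - a.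
  by rewrite /C; ring.
have Ca : a <= C.
  rewrite -subr_ge0 -C0 !addr_ge0// ?mulr_ge0// ?invr_ge0//; exact: ltW.
have aC : a * rate <= C * rate by rewrite ler_wpM2r.
have aX : 0 <= a * X by rewrite mulr_ge0.
have XC : (2 * x + y + 8 + 32 * (sU / sL) + 16 / sL + 2 * (sU ^+ 2 / sL) * y) * X
   = C * X - a * X by rewrite C0 mulrBl.
rewrite mulrDr -/X.
lra.
Qed.

Lemma exceptional_event (nu cL cU c t tau : R) (n p s : nat)
    (Sigma S : 'M[R]_p) (mu : 'cV[R]_p)
    d (T : measurableType d) (P : probability T R) (Y : 'I_n -> T -> 'cV[R]_p)
    (alphat : T -> 'cV[R]_p)
    (lambda := t * nu * Num.sqrt ((1 + tau) * ln p%:R / n%:R))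
    (X := fun w i => S *m Y i w + mu) (alpha := alpha_of mu Sigma)
    (dir : 'cV[R]_p -> 'cV[R]_p) :
  0 < nu -> 0 < cL -> 0 < cU -> 0 < c -> (0 < n)%N -> (0 < s)%N -> (0 < p)%N ->
  0 < tau -> 1 <= t ->
  s%:R * ln p%:R / n%:R < sample_threshold nu cL cU / (1 + c) ->
  symposdef Sigma -> (norm0 alpha <= s)%N -> qform Sigma alpha <= tau ->
  (forall v, cL * dotv v v <= qform Sigma v) -> (forall j, Sigma j j <= cU) ->
  S^T = S -> S *m S = Sigma -> iid_noise P nu Y ->
  (forall v, v = norm2 v *: dir v) -> (forall v, norm2 (dir v) = 1) ->
  (forall w, lasso_solution (X w) lambda (2 * Num.sqrt (tau / cL)) (alphat w)) ->
  exists2 bad : T -> R,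
    mean_le P bad (8 * p%:R `^ (- Num.min (decay_rate nu cU * t - 1) c)) &
    forall w, bad w < 1 ->
      norm2 (alphat w - alpha) ^+ 2 <= 144 / cL ^+ 2 * (lambda ^+ 2 * s%:R) /\
      2 * `|dotv (mean_hat (X w) - cov_hat (X w) *m alpha) (alphat w - alpha)|
        + qform (cov_hat (X w)) (alphat w - alpha) <= 84 / cL * (lambda ^+ 2 * s%:R).
Proof.
move=> nu0 cL0 cU0 c0 n0 s0 p0 t0 t1 sLn pS als tauq Slow diagU sS SS noise dirE dir1 sol.
(* For p = 1, ln p = 0 makes [lambda] vanish and the Lasso argument fails; but the claimed mean is
   then 8, so the whole space may be exceptional. *)
have [p1|p1] := leqP p 1.
  exists (fun=> 1); last by move=> w; rewrite ltxx.
  apply: mean_leW (mean_le_cst P ler01).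
  have -> : p = 1%N by apply/eqP; rewrite eqn_leq p1.
  by rewrite powR1; lra.
pose l : R := Num.sqrt (ln p%:R / n%:R).
have n0' : 0 < n%:R :> R by rewrite ltr0n.
have L0 : 0 < ln p%:R :> R by rewrite ln_gt0// ltr1n.
have ln0 : 0 < ln p%:R / n%:R :> R by rewrite divr_gt0.
have l0 : 0 < l by rewrite sqrtr_gt0.
(* Keeps the exponent [noise_exponent * l] within the radius where the moment generating functions
   are bounded. *)
have l1 : l <= 1.
  rewrite -(@sqrtr1 R) ler_wsqrtr//.
  have : ln p%:R / n%:R <= s%:R * ln p%:R / n%:R :> R.
    by rewrite -mulrA ler_peMl ?ler1n// ltW.
  have : sample_threshold nu cL cU / (1 + c) <= sample_threshold nu cL cU.
    have th0 := sample_threshold_gt0 cL cU nu0.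
    by rewrite ler_pdivrMr ?addr_gt0// ler_peMr ?(ltW th0)// lerDl ltW.
  have : sample_threshold nu cL cU <= 2^-1 by rewrite ge_min lexx.
  lra.
have lE : lambda = t * nu * (Num.sqrt (1 + tau) * l).
  by rewrite /lambda /l -sqrtrM ?mulrA// addr_ge0// ltW.
have st : 0 < Num.sqrt (1 + tau) by rewrite sqrtr_gt0 addr_gt0.
have tt : 0 < t := lt_le_trans ltr01 t1.
have lam0 : 0 < lambda by rewrite lE mulr_gt0 ?mulr_gt0.
have k0 := noise_ratio_gt0 nu0 cU0; have e0 := noise_exponent_gt0 nu0 cU0.
exists (fun w => exceptional S alpha dir (sparsity_factor cL cU * s)
  (noise_exponent nu cU * l) (noise_ratio nu cU * t * l) (tail_exponent nu) (Y^~ w)).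
  apply: mean_leW (tail_arithmetic nu0 cU0 c0 t1 n0 p1 s0 sLn) _.
  apply: exceptional_mean => //.
  rewrite ger0_norm; last by rewrite mulr_ge0// ltW.
  have : noise_exponent nu cU <= mgf_radius nu by rewrite ge_min lexx.
  by apply: le_trans; rewrite ler_piMr// ltW.
move=> w bad1.
apply: (lasso_error_of_exceptional n0 sS SS dirE (alpha_ofK mu pS) diagU tauq cU0
  cL0 t0 Slow lam0 als _ _ _ _ (tail_exponent_gt0 nu0) _ (sol w) bad1).
- by rewrite muln_gt0.
- rewrite natrM [leRHS]mulrA.
  have -> : 64 * (2 * cU) = 128 * cU by ring.
  by rewrite ler_wpM2r// sparsity_factor_ge.
- by rewrite !mulr_ge0// ltW.
- by rewrite mulr_gt0.
- rewrite lE /noise_ratio le_eqVlt; apply/orP; left; apply/eqP.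
  by field; rewrite gt_eqF// sqrtr_gt0.
Qed.

End Assembly.

Theorem theorem1 (R : realType) (nu cL cU : R) (nu_gt0 : 0 < nu)
    (cL_gt0 : 0 < cL) (cL_lt_cU : cL < cU) :
  exists (c1 c2 c3 : R) (ctilde : R -> R),
    [/\ 0 < c1, 0 < c2, 0 < c3,
        forall c : R, 0 < c -> 0 < ctilde c < 1 &
        ctilde c @[c --> +oo%R] --> (0 : R)] /\
    forall (c : R) (n p s : nat) (tau : R),
      0 < c -> (0 < n)%N -> (1 <= s <= p)%N -> 0 < tau ->
      s%:R * ln p%:R / n%:R < ctilde c ->
      forall t : R, Num.max 1 (2 / c2) < t ->
      let lambda := t * nu * Num.sqrt ((1 + tau) * ln p%:R / n%:R) in
      let gamma := 2 * Num.sqrt (tau / cL) in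
      let rate := t ^+ 2 * (1 + tau) * s%:R * ln p%:R / n%:R in
      (sup_risk nu cL cU s tau lambda gamma (@alpha_loss R n p)
       <= (c1 * (rate + tau * p%:R `^ (- Num.min (c2 * t - 1) c)))%:E)%E
      /\
      (sup_risk nu cL cU s tau lambda gamma (@theta_loss R n p)
       <= (c3 * (rate + (tau + Num.sqrt tau) *
             ((Num.sqrt n%:R)^-1 +
              p%:R `^ (- (Num.min (c2 * t - 2) (c - 1) / 2)))))%:E)%E.
Proof.
have cU0 : 0 < cU := lt_trans cL_gt0 cL_lt_cU.
have sL0 : 0 < Num.sqrt cL by rewrite sqrtr_gt0.
have sU0 : 0 < Num.sqrt cU by rewrite sqrtr_gt0.
have th0 := sample_threshold_gt0 cL cU nu_gt0.
have h0 := mgf_radius_gt0 nu_gt0.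
have M0 : 0 < moment_const nu by rewrite mulr_gt0 ?expR_gt0.
have x0 : 0 <= moment_const nu / mgf_radius nu.
  by rewrite divr_ge0 ?(ltW M0) ?(ltW h0).
have y0 : 0 <= 4 * moment_const nu / mgf_radius nu ^+ 2.
  by rewrite divr_ge0 ?sqr_ge0 ?mulr_ge0 ?(ltW M0).
have a0 : 0 <= 84 / cL * nu ^+ 2 by rewrite mulr_ge0 ?sqr_ge0 ?divr_ge0 ?(ltW cL_gt0).
(* 72 = 9 * 8: the loss 9 tau / cL on the exceptional event times the factor 8 in its mean. The
   factor nu^2 comes from lambda^2 s = nu^2 rate. *)
exists (144 / cL ^+ 2 * nu ^+ 2 + 72 / cL), (decay_rate nu cU),
  (theta_const nu cL cU), (fun c => sample_threshold nu cL cU / (1 + c)).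
split; first split.
- rewrite addr_gt0// ?divr_gt0// mulr_gt0 ?divr_gt0 ?exprn_gt0//.
- exact: decay_rate_gt0.
- rewrite /theta_const.
  have : 0 < Num.sqrt cU / Num.sqrt cL by rewrite divr_gt0.
  have : 0 < (Num.sqrt cL)^-1 by rewrite invr_gt0.
  have : 0 <= 2 * (cU / Num.sqrt cL) * (4 * moment_const nu / mgf_radius nu ^+ 2).
    by rewrite mulr_ge0// mulr_ge0// divr_ge0 ?(ltW cU0) ?(ltW sL0).
  lra.
- move=> c c0; rewrite divr_gt0 ?addr_gt0//= ltr_pdivrMr ?addr_gt0// mul1r.
  have : sample_threshold nu cL cU <= 2^-1 by rewrite ge_min lexx.
  lra.
- apply/cvgrPdist_lt => e e0; near=> c.
  have c0 : 0 < c by near: c; exact: nbhs_pinfty_gt.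
  rewrite sub0r normrN ger0_norm; last by rewrite divr_ge0 ?addr_ge0 ?(ltW th0) ?(ltW c0).
  rewrite ltr_pdivrMr ?addr_gt0// -ltr_pdivrMl// mulrC.
  have : sample_threshold nu cL cU / e < c.
    by near: c; apply: nbhs_pinfty_gt; exact: num_real.
  lra.
move=> c n p s tau c0 n0 /andP[s0 sp] t0 sLn t; rewrite gt_max => /andP[t1 t2].
move=> lambda gamma rate.
have p0 : (0 < p)%N := leq_trans s0 sp.
have lam0 : 0 <= lambda.
  rewrite mulr_ge0 ?sqrtr_ge0// mulr_ge0 ?(ltW nu_gt0)//.
  exact: ltW (lt_trans ltr01 t1).
have Ln0 : 0 <= ln p%:R / n%:R :> R by rewrite divr_ge0// ln_ge0// ler1n.
have lrate : lambda ^+ 2 * s%:R = nu ^+ 2 * rate.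
  rewrite /lambda exprMn sqr_sqrtr; last by rewrite -mulrA mulr_ge0// addr_ge0// ltW.
  by rewrite /rate; ring.
have rate0 : 0 <= rate.
  by rewrite /rate -mulrA mulr_ge0// mulr_ge0// mulr_ge0 ?sqr_ge0// addr_ge0// ltW.
clearbody rate; set m := Num.min (decay_rate nu cU * t - 1) c.
(* From t > 2 / c_2; it gives [Q <= 1] in the second bound. *)
have m0 : 0 <= m.
  rewrite le_min (ltW c0) andbT subr_ge0.
  move: t2; rewrite ltr_pdivrMr ?decay_rate_gt0// mulrC; lra.
(* A unit vector is chosen also for v = 0, so that the subgaussian bounds apply to every [dir v]. *)
have /choice[dir dirP] : forall v : 'cV[R]_p, exists u,
    norm2 u = 1 /\ v = norm2 v *: u.
  by move=> v; have [u] := unit_direction v p0; exists u.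
have dir1 v : norm2 (dir v) = 1 by case: (dirP v).
have dirE v : v = norm2 v *: dir v by case: (dirP v).
split; apply: ub_ereal_sup => _ [mu [Sigma [[pS [als thq lmin _ mdiag]]
  [S [d [T [P [Y [alphat [[[sS pSS] SS] noise malpha sol ->]]]]]]]]]];
  have Slow v : cL * dotv v v <= qform Sigma v :=
    le_trans (ler_wpM2r (dotvv_ge0 v) lmin) (lambda_min_le_qform v pS);
  have diagU j : Sigma j j <= cU := le_trans (diag_le_max_diag Sigma j) mdiag;
  rewrite theta_ofE// in thq;
  have [bad badm good] := exceptional_event nu_gt0 cL_gt0 cU0 c0 n0 s0 p0 t0 (ltW t1)
    sLn pS als thq Slow diagU sS SS noise dirE dir1 sol.
- have A0 : 0 <= 144 / cL ^+ 2 * (lambda ^+ 2 * s%:R).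
    by rewrite lrate mulr_ge0 ?divr_ge0 ?sqr_ge0// mulr_ge0 ?sqr_ge0.
  apply: le_trans (alpha_risk_le thq cL_gt0 t0 Slow badm sol A0
    (fun w b => (good w b).1)) _.
  rewrite lee_fin lrate -/m; set q := _ `^ _.
  have q0 : 0 <= q := powR_ge0 _ _.
  have : 0 <= 144 / cL ^+ 2 * nu ^+ 2 * (tau * q).
    apply: mulr_ge0; last by apply: mulr_ge0 => //; exact: ltW.
    by rewrite mulr_ge0 ?divr_ge0 ?sqr_ge0.
  have : 0 <= 72 / cL * rate by rewrite mulr_ge0 ?divr_ge0 ?(ltW cL_gt0).
  lra.
- have A0 : 0 <= 84 / cL * (lambda ^+ 2 * s%:R).
    by rewrite lrate mulr_ge0 ?divr_ge0 ?(ltW cL_gt0)// mulr_ge0 ?sqr_ge0.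
  set Pp := Num.sqrt (p%:R : R); set Q : R := p%:R `^ (- (m / 2)).
  have pR : 0 < p%:R :> R by rewrite ltr0n.
  have P1 : 1 <= Pp by rewrite /Pp -{1}(@sqrtr1 R) ler_wsqrtr// ler1n.
  have Q0 : 0 < Q by rewrite powR_gt0.
  have Q2 : p%:R `^ (- m) = Q ^+ 2.
    by rewrite /Q expr2 -powRD ?(gt_eqF pR) ?implybT//; congr (_ `^ _); field.
  have r0 : 0 < Pp / Q by rewrite divr_gt0// (lt_le_trans ltr01).
  rewrite /theta_loss (theta_ofE mu pS).
  apply: le_trans (theta_risk_le nu_gt0 n0 noise sS SS dirE dir1
    (alpha_ofK mu pS) diagU thq cU0 cL_gt0 t0 Slow lam0 badm sol A0 r0
    (fun w b => (good w b).2)) _.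
  rewrite lee_fin lrate -/m Q2 (mulrA (84 / cL)).
  set sg := Num.sqrt tau; have tE : tau = sg ^+ 2 by rewrite /sg sqr_sqrtr// ltW.
  have gE : Num.sqrt (tau / cL) = sg / Num.sqrt cL.
    by rewrite sqrtrM ?(ltW t0)// sqrtrV// ltW.
  have cE : cU = Num.sqrt cU ^+ 2 by rewrite sqr_sqrtr// ltW.
  have pE : p%:R = Pp ^+ 2 :> R by rewrite /Pp sqr_sqrtr.
  have NE : Num.sqrt (p%:R * (cU * tau)) = Pp * (Num.sqrt cU * sg).
    by rewrite sqrtrM// sqrtrM// ltW.
  (* The exponents of the second bound are those of the first lowered by 1, so the power is p^(-(m -
     1)/2), the product of sqrt p and p^(-m/2). *)
  have zE : p%:R `^ (- (Num.min (decay_rate nu cU * t - 2) (c - 1) / 2)) = Pp * Q.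
    have -> : Num.min (decay_rate nu cU * t - 2) (c - 1) = m - 1.
      rewrite /m addr_minl; congr Num.min; ring.
    rewrite /Pp -powR12_sqrt ?(ltW pR)// /Q -powRD ?(gt_eqF pR) ?implybT//.
    by congr (_ `^ _); field.
  rewrite zE gE NE.
  set w := (Num.sqrt n%:R)^-1.
  have n1 : 1 <= Num.sqrt n%:R :> R by rewrite -{1}(@sqrtr1 R) ler_wsqrtr// ler1n.
  have w0 : 0 <= w by rewrite invr_ge0 sqrtr_ge0.
  have w1 : w <= 1 by rewrite invf_le1// (lt_le_trans ltr01).
  have nE : n%:R^-1 = w ^+ 2 :> R by rewrite /w exprVn sqr_sqrtr.
  have Q1 : Q <= 1.
    rewrite /Q /powR (gt_eqF pR) expR_le1 mulNr oppr_le0.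
    by apply: mulr_ge0; [exact: divr_ge0|apply: ln_ge0; rewrite ler1n].
  have := theta_rate_arithmetic (sqrtr_ge0 tau) sL0 sU0 x0 y0 a0 rate0 P1 Q0 Q1 w0 w1.
  rewrite -/sg -tE -cE -pE /theta_const; apply: le_trans.
  have nn : n%:R != 0 :> R by rewrite pnatr_eq0 -lt0n.
  have hh : mgf_radius nu != 0 by rewrite gt_eqF.
  have -> : 4 / (mgf_radius nu ^+ 2 * n%:R) * moment_const nu =
      4 * moment_const nu / mgf_radius nu ^+ 2 * w ^+ 2.
    by rewrite -nE; field; rewrite nn hh.
  have -> : (mgf_radius nu * Num.sqrt n%:R)^-1 * moment_const nu =
      moment_const nu / mgf_radius nu * w.
    by rewrite invfM -/w; ring.
  exact: lexx.
Unshelve. all: by end_near.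
Qed.
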